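(* Let $K$ be a field of characteristic $p>0$, and let $g,h\in S=K[x_1,\ldots,x_n]$ be square-free supported homogeneous polynomials satisfying $\deg(h)=1+\deg(g)$. Let $\ell=a_1x_1+\cdots+a_nx_n+1$ for some $a_1,\ldots,a_n\in K$. If $g$ is irreducible and does not divide $h$, then $f=g\ell+h$ is geometrically irreducible and $S/(f)$ is geometrically F-rational.
   Context: A polynomial in $S=K[x_1,\ldots,x_n]$ is square-free supported if every monomial appearing in it with non-zero coefficient is square-free (equivalently, it has degree at most one in each variable). A polynomial $f\in S$ is geometrically irreducible if its image in $S\otimes_K L\cong L[x_1,\ldots,x_n]$ is irreducible for every field extension $L$ of $K$. A Noetherian ring $R$ of prime characteristic $p$ is F-rational if every parameter ideal of $R$ is tightly closed. An ideal $I=(r_1,\ldots,r_m)$ of $R$ is a parameter ideal if for every prime ideal $\mathfrak p\supseteq I$ the images of $r_1,\ldots,r_m$ in $R_{\mathfrak p}$ form part of a system of parameters of $R_{\mathfrak p}$. An ideal $I$ is tightly closed if $I=I^*$, where $I^*$ is the set of $r\in R$ for which there is $c\in R$ not in any minimal prime of $R$ with $cr^{p^e}\in I^{[p^e]}$ for all $e\gg 0$; here $I^{[p^e]}$ is the ideal generated by the $p^e$-th powers of elements of $I$. For $R=S/I$, $R$ is geometrically F-rational if $R\otimes_K L$ is F-rational for every field extension $L$ of $K$. *)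

(* Defs.v *)
From HB Require Import structures.
From mathcomp Require Import all_boot all_algebra.
From mathcomp Require Import generic_quotient ring_quotient.
From mathcomp Require Import boolp mpoly ring.

Set Implicit Arguments.
Unset Strict Implicit.
Unset Printing Implicit Defensive.

Import GRing.Theory.
Local Open Scope ring_scope.
Local Open Scope quotient_scope.

(* Ideals of a ring R that may be the unit ideal are predicates R -> Prop; prime
   ideals (which are proper) are elements of the library type prime_idealr R. *)

Section Ideals.

Variable R : comNzRingType.
Implicit Types (I A : R -> Prop) (P Q : prime_idealr R).

Definition is_ideal I :=
  I 0 /\ forall a u v : R, I u -> I v -> I (a * u + v).

Definition ideal_span A : R -> Prop :=
  fun u => forall I, is_ideal I -> (forall a, A a -> I a) -> I u.

Definition ideal_of_seq (r : seq R) : R -> Prop := ideal_span (fun a => a \in r).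

Definition noetherian :=
  forall I, is_ideal I -> exists r : seq R, forall u, I u <-> ideal_of_seq r u.

Definition is_minimal_prime P :=
  forall Q, {subset Q <= P} -> {subset P <= Q}.

Definition has_prime_chain (d : nat) :=
  exists c : 'I_d.+1 -> prime_idealr R,
    forall i j : 'I_d.+1, (i < j)%N ->
      {subset c i <= c j} /\ ~ {subset c j <= c i}.

Definition has_krull_dim (d : nat) :=
  has_prime_chain d /\ forall e, has_prime_chain e -> (e <= d)%N.

Definition ideal_radical I : R -> Prop := fun a => exists k : nat, I (a ^+ k).

(* For a local ring, the set of non-units is the maximal ideal. *)
Definition nonunits : R -> Prop := fun a => ~ exists b : R, a * b = 1.

(* Meaningful for a Noetherian local ring R: r has dim R elements and generates
   an ideal that is primary to the maximal ideal. *)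
Definition is_sop (r : seq R) :=
  has_krull_dim (size r) /\
  forall a, ideal_radical (ideal_of_seq r) a <-> nonunits a.

Definition is_part_of_sop (r : seq R) := exists r' : seq R, is_sop (r ++ r').

End Ideals.

(* The localization R_P at a prime P, as the quotient of the set of pairs (a, s)
   with s outside P; R may have zero divisors. *)
Section Localization.

Variables (R : comNzRingType) (P : prime_idealr R).

Definition loc_pair : Type := (R * {s : R | s \notin P})%type.
HB.instance Definition _ := Choice.on loc_pair.

Implicit Types x y z : loc_pair.

Definition loc_equiv x y : bool :=
  `[< exists2 u : R, u \notin P & u * (x.1 * sval y.2 - y.1 * sval x.2) = 0 >].

Lemma loc_denom1 : (1 : R) \notin P.
Proof. by rewrite idealr1. Qed.

Lemma loc_denomM (s t : R) : s \notin P -> t \notin P -> s * t \notin P.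
Proof. by move=> sP tP; rewrite prime_idealrM negb_or sP tP. Qed.

Lemma loc_equivP x y :
  reflect (exists2 u : R, u \notin P & u * (x.1 * sval y.2) = u * (y.1 * sval x.2))
          (loc_equiv x y).
Proof.
apply: (iffP (asboolP _)) => -[u uP e]; exists u => //.
  by apply/eqP; rewrite -subr_eq0 -mulrBr e.
by rewrite mulrBr e subrr.
Qed.

Lemma loc_equiv_refl : reflexive loc_equiv.
Proof. by move=> x; apply/loc_equivP; exists 1; rewrite ?loc_denom1. Qed.

Lemma loc_equiv_sym : ssrbool.symmetric loc_equiv.
Proof.
by move=> x y; apply/loc_equivP/loc_equivP => -[u uP e]; exists u.
Qed.

Lemma loc_equiv_trans : transitive loc_equiv.
Proof.
move=> y x z /loc_equivP[u uP e] /loc_equivP[v vP e']; apply/loc_equivP.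
exists (u * v * sval y.2); first by rewrite !loc_denomM ?(valP y.2).
transitivity (v * sval z.2 * (u * (x.1 * sval y.2))); first by ring.
transitivity (u * sval x.2 * (v * (y.1 * sval z.2))); first by rewrite e; ring.
by rewrite e'; ring.
Qed.

Canonical loc_equiv_equiv :=
  EquivRel loc_equiv loc_equiv_refl loc_equiv_sym loc_equiv_trans.
Canonical loc_equiv_encModRel := defaultEncModRel loc_equiv.

Definition localization : Type := {eq_quot loc_equiv}.
HB.instance Definition _ : EqQuotient loc_pair loc_equiv localization :=
  EqQuotient.on localization.
HB.instance Definition _ := Choice.on localization.


Lemma loc_eqP x y : reflect
  (exists2 u : R, u \notin P & u * (x.1 * sval y.2) = u * (y.1 * sval x.2))
  (x == y %[mod localization]).
Proof. by rewrite piE; apply: loc_equivP. Qed.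

Definition loc_one_denom : {s : R | s \notin P} := exist _ 1 loc_denom1.
Definition loc_mul_denom (s t : {s : R | s \notin P}) : {s : R | s \notin P} :=
  exist _ (sval s * sval t) (loc_denomM (valP s) (valP t)).

Definition loc_embed (a : R) : loc_pair := (a, loc_one_denom).
Definition loc_map (a : R) : localization := \pi_localization (loc_embed a).

Definition loc_addp x y : loc_pair :=
  (x.1 * sval y.2 + y.1 * sval x.2, loc_mul_denom x.2 y.2).
Definition loc_oppp x : loc_pair := (- x.1, x.2).
Definition loc_mulp x y : loc_pair := (x.1 * y.1, loc_mul_denom x.2 y.2).

Definition loc_add := lift_op2 localization loc_addp.
Definition loc_opp := lift_op1 localization loc_oppp.
Definition loc_mul := lift_op2 localization loc_mulp.

Lemma loc_repr x : exists2 u : R, u \notin P &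
  u * (x.1 * sval (repr (\pi_localization x)).2)
  = u * ((repr (\pi_localization x)).1 * sval x.2).
Proof. by apply/loc_eqP; rewrite reprK. Qed.

Lemma pi_loc_add : {morph \pi_localization : x y / loc_addp x y >-> loc_add x y}.
Proof.
move=> x y; unlock loc_add; apply/eqP/loc_eqP => /=.
have [u uP e] := loc_repr x; have [v vP e'] := loc_repr y.
move: (repr (\pi x)) (repr (\pi y)) e e' => x' y' e e'.
exists (u * v); rewrite ?loc_denomM //.
transitivity (u * (x.1 * sval x'.2) * (v * sval y.2 * sval y'.2)
  + v * (y.1 * sval y'.2) * (u * sval x.2 * sval x'.2)); first by ring.
by rewrite e e'; ring.
Qed.
Canonical pi_loc_add_morph := PiMorph2 pi_loc_add.

Lemma pi_loc_opp : {morph \pi_localization : x / loc_oppp x >-> loc_opp x}.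
Proof.
move=> x; unlock loc_opp; apply/eqP/loc_eqP => /=.
have [u uP e] := loc_repr x; move: (repr _) e => x' e.
by exists u; rewrite // !mulNr !mulrN e.
Qed.
Canonical pi_loc_opp_morph := PiMorph1 pi_loc_opp.

Lemma pi_loc_mul : {morph \pi_localization : x y / loc_mulp x y >-> loc_mul x y}.
Proof.
move=> x y; unlock loc_mul; apply/eqP/loc_eqP => /=.
have [u uP e] := loc_repr x; have [v vP e'] := loc_repr y.
move: (repr (\pi x)) (repr (\pi y)) e e' => x' y' e e'.
exists (u * v); rewrite ?loc_denomM //.
transitivity (u * (x.1 * sval x'.2) * (v * (y.1 * sval y'.2))); first by ring.
by rewrite e e'; ring.
Qed.
Canonical pi_loc_mul_morph := PiMorph2 pi_loc_mul.

Lemma loc_eq x y : x.1 * sval y.2 = y.1 * sval x.2 -> x = y %[mod localization].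
Proof.
by move=> e; apply/eqP/loc_eqP; exists 1; rewrite ?loc_denom1 // e.
Qed.

Lemma loc_addA : associative loc_add.
Proof.
elim/quotW=> x; elim/quotW=> y; elim/quotW=> z; rewrite !piE.
by apply: loc_eq => /=; ring.
Qed.

Lemma loc_addC : commutative loc_add.
Proof.
by elim/quotW=> x; elim/quotW=> y; rewrite !piE; apply: loc_eq => /=; ring.
Qed.

Lemma loc_add0 : left_id (loc_map 0) loc_add.
Proof. by elim/quotW=> x; rewrite /loc_map !piE; apply: loc_eq => /=; ring. Qed.

Lemma loc_addN : left_inverse (loc_map 0) loc_opp loc_add.
Proof. by elim/quotW=> x; rewrite /loc_map !piE; apply: loc_eq => /=; ring. Qed.

HB.instance Definition _ :=
  GRing.isZmodule.Build localization loc_addA loc_addC loc_add0 loc_addN.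

Lemma loc_mulA : associative loc_mul.
Proof.
elim/quotW=> x; elim/quotW=> y; elim/quotW=> z; rewrite !piE.
by apply: loc_eq => /=; ring.
Qed.

Lemma loc_mulC : commutative loc_mul.
Proof.
by elim/quotW=> x; elim/quotW=> y; rewrite !piE; apply: loc_eq => /=; ring.
Qed.

Lemma loc_mul1 : left_id (loc_map 1) loc_mul.
Proof. by elim/quotW=> x; rewrite /loc_map !piE; apply: loc_eq => /=; ring. Qed.

Lemma loc_mulDl : left_distributive loc_mul loc_add.
Proof.
elim/quotW=> x; elim/quotW=> y; elim/quotW=> z; rewrite !piE.
by apply: loc_eq => /=; ring.
Qed.

Lemma loc_1_neq0 : loc_map 1 != loc_map 0.
Proof.
apply/negP => /loc_eqP[u uP] /=; rewrite !mulr1 mulr0 => u0.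
by move: uP; rewrite u0 rpred0.
Qed.

HB.instance Definition _ := GRing.Zmodule_isComNzRing.Build localization
  loc_mulA loc_mulC loc_mul1 loc_mulDl loc_1_neq0.

Lemma loc_map_is_zmod_morphism : zmod_morphism loc_map.
Proof.
move=> a b; transitivity (loc_add (loc_map a) (loc_opp (loc_map b))) => //.
by rewrite /loc_map !piE; apply: loc_eq => /=; ring.
Qed.

Lemma loc_map_is_monoid_morphism : monoid_morphism loc_map.
Proof.
split=> // a b; transitivity (loc_mul (loc_map a) (loc_map b)) => //.
by rewrite /loc_map !piE; apply: loc_eq => /=; ring.
Qed.

HB.instance Definition _ :=
  GRing.isZmodMorphism.Build R localization loc_map loc_map_is_zmod_morphism.
HB.instance Definition _ :=
  GRing.isMonoidMorphism.Build R localization loc_map loc_map_is_monoid_morphism.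

Lemma loc_mapP (x : localization) :
  exists a s : R, s \notin P /\ x * loc_map s = loc_map a.
Proof.
elim/quotW: x => -[a [s sP]]; exists a, s; split=> //.
transitivity (loc_mul (\pi_localization (a, exist _ s sP)) (loc_map s)) => //.
by rewrite /loc_map !piE; apply: loc_eq => /=; ring.
Qed.

Lemma loc_map_inv (s : R) : s \notin P -> exists t : localization, loc_map s * t = 1.
Proof.
move=> sP; exists (\pi_localization (1, exist _ s sP)).
transitivity (loc_mul (loc_map s) (\pi_localization (1, exist _ s sP))) => //.
rewrite /loc_map piE; transitivity (loc_map 1) => //.
by apply: loc_eq => /=; ring.
Qed.

Lemma loc_map_eq0 (a : R) : loc_map a = 0 <-> exists2 u, u \notin P & u * a = 0.
Proof.
split=> [/eqP/loc_eqP[u uP] /= | [u uP e]].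
  by rewrite !mulr1 mulr0; exists u.
by apply/eqP/loc_eqP; exists u; rewrite //= !mulr1 mulr0.
Qed.

End Localization.

Section FRational.

Variables (p : nat) (R : comNzRingType).
Implicit Type I : R -> Prop.

Definition is_parameter_ideal I :=
  exists r : seq R, (forall u, I u <-> ideal_of_seq r u) /\
    forall P : prime_idealr R, (forall u, I u -> u \in P) ->
      is_part_of_sop [seq loc_map P a | a <- r].

(* I^[q] *)
Definition frobenius_power I (q : nat) : R -> Prop :=
  ideal_span (fun v => exists2 w, I w & v = w ^+ q).

Definition tight_closure I : R -> Prop := fun r =>
  exists2 c : R, forall P : prime_idealr R, is_minimal_prime P -> c \notin P &
  exists e0 : nat, forall e, (e0 <= e)%N ->
    frobenius_power I (p ^ e) (c * r ^+ (p ^ e)).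

Definition tightly_closed I := forall r, tight_closure I r <-> I r.

Definition F_rational :=
  [/\ noetherian R, p \in [pchar R] &
     forall I, is_parameter_ideal I -> tightly_closed I].

End FRational.

Section Polynomials.

Variables (n : nat) (K : fieldType).
Implicit Type f : {mpoly K[n]}.

Definition square_free_supported f :=
  forall m : 'X_{1..n}, m \in msupp f -> forall i, (m i <= 1)%N.

Definition mpoly_irreducible f :=
  [/\ f != 0, f \isn't a GRing.unit &
     forall u v : {mpoly K[n]}, f = u * v ->
       (u \is a GRing.unit) \/ (v \is a GRing.unit)].

Definition mpoly_divides f1 f2 := exists u : {mpoly K[n]}, f2 = u * f1.

End Polynomials.

Definition geometrically_irreducible (n : nat) (K : fieldType)
    (f : {mpoly K[n]}) :=
  forall (L : fieldType) (iota : {rmorphism K -> L}),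
    mpoly_irreducible (map_mpoly iota f).

(* The extension I L[x] of an ideal I of K[x] along K -> L. *)
Definition extended_ideal (n : nat) (K L : fieldType)
    (iota : {rmorphism K -> L}) (I : {mpoly K[n]} -> Prop) : {mpoly L[n]} -> Prop :=
  ideal_span (fun v => exists2 w, I w & v = map_mpoly iota w).

(* (K[x]/I) (x)_K L is realized as L[x]/J with J = I L[x]; see
   base_change_pushout.  Elements of idealr are proper ideals; no ring is lost, as
   a ring of prime characteristic p is non-zero. *)
Definition geometrically_F_rational (p n : nat) (K : fieldType)
    (I : {mpoly K[n]} -> Prop) :=
  forall (L : fieldType) (iota : {rmorphism K -> L}),
    exists J : idealr {mpoly L[n]},
      (forall u, u \in J <-> extended_ideal iota I u) /\
      F_rational p {ideal_quot J}.

Lemma ideal_of_idealr (R : comNzRingType) (J : idealr R) :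
  is_ideal (fun u => u \in J).
Proof. by split=> [|a u v uJ vJ]; rewrite ?rpred0 // rpredD // idealMr. Qed.

Lemma ideal_quot_lift (R T : comNzRingType) (I : idealr R) (f : {rmorphism R -> T}) :
  (forall a, a \in I -> f a = 0) ->
  exists g : {rmorphism {ideal_quot I} -> T}, forall a, g (\pi a) = f a.
Proof.
move=> fI; pose g (x : {ideal_quot I}) := f (repr x).
have gpi a : g (\pi a) = f a.
  apply/eqP; rewrite -subr_eq0 -rmorphB; apply/eqP/fI.
  by rewrite Quotient.idealrBE reprK.
have gB : zmod_morphism g.
  elim/quotW=> x; elim/quotW=> y.
  by rewrite !gpi -[RHS]rmorphB -gpi; congr g; exact/esym/pi_is_zmod_morphism.
have gM : monoid_morphism g.
  split; first by rewrite -(rmorph1 f) -gpi; congr g; exact/esym/pi_oner.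
  elim/quotW=> x; elim/quotW=> y.
  by rewrite !gpi -[RHS]rmorphM -gpi; congr g; exact/esym/pi_mulr.
pose gZ := GRing.isZmodMorphism.Build _ _ g gB.
pose gR := GRing.isMonoidMorphism.Build _ _ g gM.
pose G : {rmorphism {ideal_quot I} -> T} := HB.pack g gZ gR.
by exists G.
Qed.

Lemma mpoly_rmorph_ext (n : nat) (L : fieldType) (T : comNzRingType)
    (w w' : {rmorphism {mpoly L[n]} -> T}) :
  (forall c, w c%:MP = w' c%:MP) -> (forall i, w 'X_i = w' 'X_i) -> w =1 w'.
Proof.
move=> wC wX q; rewrite [q]mpolyE !rmorph_sum; apply: eq_bigr => m _.
rewrite -mul_mpolyC !rmorphM wC mpolyXE_id !rmorph_prod; congr (_ * _).
by apply: eq_bigr => i _; rewrite !rmorphXn wX.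
Qed.

(* L[x]/IL[x] is the pushout of K[x]/I <- K -> L in commutative rings. *)
Lemma base_change_pushout (n : nat) (K L : fieldType) (iota : {rmorphism K -> L})
    (I : idealr {mpoly K[n]}) (J : idealr {mpoly L[n]})
    (JE : forall u, u \in J <-> extended_ideal iota (fun w => w \in I) u) :
  exists (i : {rmorphism {ideal_quot I} -> {ideal_quot J}})
         (j : {rmorphism L -> {ideal_quot J}}),
    (forall c, i (\pi c%:MP) = j (iota c)) /\
    forall (T : comNzRingType) (u : {rmorphism {ideal_quot I} -> T})
           (v : {rmorphism L -> T}),
      (forall c, u (\pi c%:MP) = v (iota c)) ->
      (exists w : {rmorphism {ideal_quot J} -> T}, w \o i =1 u /\ w \o j =1 v) /\
      (forall w w' : {rmorphism {ideal_quot J} -> T},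
        w \o i =1 u -> w \o j =1 v -> w' \o i =1 u -> w' \o j =1 v -> w =1 w').
Proof.
pose pI : {rmorphism {mpoly K[n]} -> {ideal_quot I}} := \pi_{ideal_quot I}.
pose pJ : {rmorphism {mpoly L[n]} -> {ideal_quot J}} := \pi_{ideal_quot J}.
have pI0 a : a \in I -> pI a = 0.
  move=> aI; rewrite -(rmorph0 pI); apply/eqP.
  by rewrite -Quotient.idealrBE subr0.
have pJ0 a : a \in J -> pJ a = 0.
  move=> aJ; rewrite -(rmorph0 pJ); apply/eqP.
  by rewrite -Quotient.idealrBE subr0.
have [i iE] : exists i : {rmorphism {ideal_quot I} -> {ideal_quot J}},
    forall a, i (pI a) = pJ (map_mpoly iota a).
  apply: (@ideal_quot_lift _ _ I (pJ \o map_mpoly iota)) => a aI /=.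
  by apply/pJ0/JE => Z _; apply; exists a.
exists i, (pJ \o mpolyC n (R := L)); split=> [c|T u v uv].
  by rewrite [LHS]iE map_mpolyC.
have vC x y : GRing.comm (v x) y by exact: mulrC.
pose h k := u (pI 'X_k).
pose W : {rmorphism {mpoly L[n]} -> T} := mmap v h.
have WC c : W c%:MP = v c by exact: mmapC.
have Wmap a : W (map_mpoly iota a) = u (pI a).
  move: a; pose W1 : {rmorphism {mpoly K[n]} -> T} := W \o map_mpoly iota.
  pose W2 : {rmorphism {mpoly K[n]} -> T} := u \o pI.
  apply: (@mpoly_rmorph_ext _ _ _ W1 W2) => [c|k].
    by rewrite /W1 /W2 /= map_mpolyC [LHS]WC -uv.
  by rewrite /W1 /W2 /= map_mpolyX /W mmapX mmap1U.
split=> [|w w' wi wj wi' wj'].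
  have [a aJ|w wE] := @ideal_quot_lift _ _ J W.
    move/JE: aJ => /(_ (fun a => W a = 0)); apply.
      by split=> [|b c d]; rewrite ?rmorph0 // rmorphD rmorphM => -> ->;
         rewrite mulr0 addr0.
    by move=> _ [b bI ->]; rewrite Wmap pI0 // rmorph0.
  exists w; split=> [|c]; last by rewrite /= [LHS]wE WC.
  by elim/quotW=> a; rewrite /= [i _]iE [LHS]wE Wmap.
elim/quotW=> q; move: q.
apply: (@mpoly_rmorph_ext _ _ _ (w \o pJ) (w' \o pJ)) => [c|k] /=.
  by rewrite [LHS]wj [RHS]wj'.
have <- : i (pI 'X_k) = pJ 'X_k by rewrite iE map_mpolyX.
by rewrite [LHS]wi [RHS]wi'.
Qed.

(* Main.v *)
Require Import Defs.
From HB Require Import structures.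
From mathcomp Require Import all_boot order all_algebra.
From mathcomp Require Import mpoly.
From mathcomp Require Import generic_quotient ring_quotient boolp ring zify.

Set Implicit Arguments.
Unset Strict Implicit.
Unset Printing Implicit Defensive.

Import Order.TTheory GRing.Theory.
Local Open Scope ring_scope.

(** Write lambda for the linear part of l, so that f = g + t with
    t = g * lambda + h.  Here g is homogeneous of degree d and t of degree d + 1,
    and g does not divide t.  After any extension of the field of coefficients
    this picture persists, because a square-free polynomial factors into
    polynomials in disjoint sets of variables and the factors can be read off from
    its coefficients (factor_descent): g stays irreducible and still does not
    divide h.  So everything takes place over one field L of characteristic p.

    A square-free irreducible polynomial is prime (sqfree_irreducible_prime).
    Modulo f one has g = - t, hence multiplying by a power of g makes any
    polynomial homogeneous modulo f (homogenize), while a non-zero homogeneous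
    polynomial is never a multiple of f (deformation_ndvd_homog).  It follows that
    f is prime, in particular irreducible.

    For R = L[x]/(f) every ideal is shown to be tightly closed, not only the
    parameter ideals.  Suppose that c r^q lies in I^[q] + (f) for all large q = p^e.
    Then u r^q lies in I^[q] for u = c f^(q-1), as in Fedder's criterion.  If some
    monomial x^b with all exponents below q occurs in u, and no monomial
    x^(q m + b) with m <> 0 does, then extracting from u r^q in I^[q] the monomials
    congruent to b modulo q gives r^q in I^[q], with the coefficients of L regarded
    as an extension of their q-th powers, and hence r in I (cartier_descent).

    To find x^b, take c homogeneous.  Then c f^(q-1) is up to signs the sum of the
    forms c g^(q-1-j) t^j for 0 <= j < q.  These have distinct degrees within less
    than q of each other, so any monomial of one of them with exponents below q
    will do (deformation_monomial).  Such a monomial is obtained from the following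
    property of g, which expresses that L[x]/(g) is F-regular at the origin: if g
    does not divide c, then c g^(q-1) has a monomial with all exponents below q,
    for some arbitrarily large q (sqfree_prime_low).  It is proved by adding the
    variables one at a time to the set of those whose exponents are bounded.  For
    the variable x_i write g = x_i a + b.  As c may be assumed to be free of x_i,
    the powers of x_i separate the terms c a^j b^(q-1-j) of c g^(q-1), and the
    question becomes one about powers of the ideal (a, b).  The induction
    hypothesis for c = a gives a product a^i b^j with i + j = q_0 and exponents
    below q_0, and raising it to the power q_1 leaves room for a multiplication by
    any non-zero c (low_mul_frobenius). *)

(** * Monomials of products, and the degree in one variable *)
Lemma seq_argmin (T : eqType) (mu : T -> nat) (s : seq T) :
  s != [::] -> exists2 x, x \in s & forall y, y \in s -> (mu x <= mu y)%N.
Proof.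
case: s => // z s _; set s' := z :: s.
have ex : exists k, has (fun x => mu x == k) s'.
  by exists (mu z); apply/hasP; exists z; rewrite ?inE ?eqxx.
case: (ex_minnP ex) => k /hasP[x xs /eqP xk] kmin; exists x => // y ys.
by rewrite xk; apply: kmin; apply/hasP; exists y.
Qed.

Lemma seq_argmax (T : eqType) (mu : T -> nat) (s : seq T) :
  s != [::] -> exists2 x, x \in s & forall y, y \in s -> (mu y <= mu x)%N.
Proof.
move=> s0; have [x xs xmin] := seq_argmin (fun x => (\max_(y <- s) mu y - mu x)%N) s0.
exists x => // y ys; have := xmin y ys.
have bnd z : z \in s -> (mu z <= \max_(y <- s) mu y)%N by move=> zs; exact: leq_bigmax_seq.
by have := bnd y ys; have := bnd x xs; lia.
Qed.

Section Parts.
Variables (n : nat) (L : fieldType).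
Implicit Types (u v w : {mpoly L[n]}) (m : 'X_{1..n}).

Definition monomial_ext (E : 'X_{1..n} -> {mpoly L[n]}) v : {mpoly L[n]} :=
  \sum_(m <- msupp v) v@_m *: E m.

Lemma monomial_ext_wide E v (s : seq 'X_{1..n}) :
  uniq s -> {subset msupp v <= s} ->
  monomial_ext E v = \sum_(m <- s) v@_m *: E m.
Proof.
move=> us sub; rewrite (bigID (fun m => m \in msupp v)) /=.
rewrite [X in _ + X]big1 ?addr0; last first.
  by move=> m /memN_msupp_eq0 ->; rewrite scale0r.
rewrite -big_filter; apply: perm_big; apply: uniq_perm.
- exact: msupp_uniq.
- exact: filter_uniq.
by move=> m; rewrite mem_filter andb_idr //; exact: sub.
Qed.

Lemma monomial_ext_linear E : linear (monomial_ext E).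
Proof.
move=> c u v; pose s := undup (msupp (c *: u + v) ++ msupp u ++ msupp v).
rewrite !(@monomial_ext_wide _ _ s) ?undup_uniq //; first last.
- by move=> m mu; rewrite mem_undup !mem_cat mu.
- by move=> m mu; rewrite mem_undup !mem_cat mu orbT.
- by move=> m mu; rewrite mem_undup !mem_cat mu !orbT.
rewrite scaler_sumr -big_split /=; apply: eq_bigr => m _.
by rewrite mcoeffD mcoeffZ scalerDl scalerA.
Qed.

HB.instance Definition _ E :=
  GRing.isLinear.Build L {mpoly L[n]} {mpoly L[n]} _ (monomial_ext E)
    (monomial_ext_linear E).

Lemma monomial_extX E m : monomial_ext E 'X_[m] = E m.
Proof. by rewrite /monomial_ext msuppX big_seq1 mcoeffX eqxx scale1r. Qed.

Definition part (P : pred 'X_{1..n}) :=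
  monomial_ext (fun m => if P m then 'X_[m] else 0).

Lemma mcoeff_part P v m : (part P v)@_m = if P m then v@_m else 0.
Proof.
rewrite [in RHS](mpolyE v) /part /monomial_ext !raddf_sum /=.
transitivity (\sum_(k <- msupp v) if P m then (v@_k *: 'X_[k])@_m else 0); last first.
  by case: (P m); [|rewrite big1].
apply: eq_bigr => k _; rewrite !mcoeffZ mcoeffX.
have [->|km] := eqVneq k m; first by case: (P m); rewrite ?mcoeffX ?mcoeff0 ?eqxx ?mulr0.
by case: (P k); rewrite ?mcoeffX ?(negPf km) ?mcoeff0 mulr0 if_same.
Qed.

Lemma msupp_part P v m : (m \in msupp (part P v)) = P m && (m \in msupp v).
Proof. by rewrite !mcoeff_msupp mcoeff_part; case: (P m); rewrite // eqxx. Qed.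

Lemma part_split P v : v = part P v + part (predC P) v.
Proof.
by apply/mpolyP => m; rewrite mcoeffD !mcoeff_part /=; case: (P m);
   rewrite ?addr0 ?add0r.
Qed.

Lemma msuppM_ex u v m : m \in msupp (u * v) ->
  exists m1 m2, [/\ m1 \in msupp u, m2 \in msupp v & m = (m1 + m2)%MM].
Proof. by move/msuppM_le/allpairsP => [[m1 m2] /= [? ? ->]]; exists m1, m2. Qed.

(** Cancellation in a product can be excluded by comparing with the product of two
    faces of the factors, when no other pair of monomials has the same sum. *)
Lemma mcoeffM_part P Q u v m :
  (forall m1 m2, m1 \in msupp u -> m2 \in msupp v -> m = (m1 + m2)%MM ->
     P m1 && Q m2) ->
  (u * v)@_m = (part P u * part Q v)@_m.
Proof.
move=> PQ; rewrite {1}(part_split P u) {1}(part_split Q v) !mulrDl !mulrDr.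
rewrite !mcoeffD -[RHS]addr0 -addrA; congr (_ + _).
rewrite !memN_msupp_eq0 ?addr0 //; apply/negP => /msuppM_ex[m1 [m2 []]];
  rewrite !msupp_part => /andP[P1 s1] /andP[P2 s2] e.
all: by move: (PQ _ _ s1 s2 e) P1 P2 => /= /andP[-> ->].
Qed.

Lemma mcoeffM_uniq u v m1 m2 :
  (forall m m', m \in msupp u -> m' \in msupp v -> (m1 + m2 = m + m')%MM ->
     m = m1 /\ m' = m2) ->
  (u * v)@_(m1 + m2) = u@_m1 * v@_m2.
Proof.
move=> U; rewrite (@mcoeffM_part (pred1 m1) (pred1 m2)); last first.
  by move=> m m' mu mv e; have [-> ->] := U _ _ mu mv e; rewrite /= !eqxx.
have one w k : part (pred1 k) w = w@_k *: 'X_[k].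
  apply/mpolyP => m; rewrite mcoeff_part mcoeffZ mcoeffX /= [k == m]eq_sym.
  by case: eqP => [->|_]; rewrite ?mulr1 ?mulr0.
by rewrite !one -scalerAl -scalerAr -mpolyXD !mcoeffZ mcoeffX eqxx mulr1.
Qed.

(** The polynomial ring being a domain, the product of two non-zero faces has a
    monomial; if other pairs cannot contribute to it, it occurs in u * v. *)
Lemma msuppM_part P Q u v :
  part P u != 0 -> part Q v != 0 ->
  (forall m1 m2 m1' m2', m1 \in msupp u -> m2 \in msupp v ->
     m1' \in msupp u -> m2' \in msupp v -> P m1' -> Q m2' ->
     (m1' + m2' = m1 + m2)%MM -> P m1 && Q m2) ->
  exists m1 m2, [/\ m1 \in msupp u, m2 \in msupp v, P m1, Q m2
                  & (m1 + m2)%MM \in msupp (u * v)].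
Proof.
move=> u0 v0 PQ; have := mulf_neq0 u0 v0; rewrite -msupp_eq0.
case E: (msupp _) => [//|m s] _.
have : m \in msupp (part P u * part Q v) by rewrite E mem_head.
move=> ms; have [m1 [m2 []]] := msuppM_ex ms.
rewrite !msupp_part => /andP[P1 s1] /andP[Q2 s2] e; exists m1, m2; split=> //.
rewrite mcoeff_msupp -e (@mcoeffM_part P Q) -?mcoeff_msupp // => k1 k2 k1s k2s ek.
by apply: (PQ k1 k2 m1 m2) => //; rewrite -e -ek.
Qed.

Lemma part_neq0 (P : pred _) v m : m \in msupp v -> P m -> part P v != 0.
Proof.
by move=> mv Pm; apply/eqP => e; have := msupp_part P v m; rewrite Pm mv e msupp0.
Qed.

Lemma ex_msupp u : u != 0 -> exists m, m \in msupp u.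
Proof. by rewrite -msupp_eq0; case: (msupp u) => // m s _; exists m; rewrite mem_head. Qed.

Definition degi (i : 'I_n) v : nat := \max_(m <- msupp v) m i.

Lemma degi_le i v m : m \in msupp v -> (m i <= degi i v)%N.
Proof. by move=> mv; exact: (leq_bigmax_seq _ mv). Qed.

Lemma degi_leP i v k : (forall m, m \in msupp v -> (m i <= k)%N) <-> (degi i v <= k)%N.
Proof.
split=> [H|H m mv]; last exact: leq_trans (degi_le i mv) H.
by apply/bigmax_leqP_seq => m mv _; apply: H.
Qed.

Lemma degi_ex i v : v != 0 -> exists2 m, m \in msupp v & m i = degi i v.
Proof.
rewrite -msupp_eq0 => /(seq_argmax (fun m : 'X_{1..n} => m i))[m mv mmax].
by exists m => //; apply/eqP; rewrite eqn_leq degi_le //=; apply/degi_leP.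
Qed.

Lemma degi0P i v m : degi i v = 0%N -> m \in msupp v -> m i = 0%N.
Proof. by move=> v0 /(degi_le i); rewrite v0 leqn0 => /eqP. Qed.

Lemma degi0 i : degi i 0 = 0%N.
Proof. by rewrite /degi msupp0 big_nil. Qed.

Lemma degiC i c : degi i c%:MP = 0%N.
Proof.
apply/eqP; rewrite -leqn0; apply/degi_leP => m; rewrite msuppC.
by case: ifP => //; rewrite inE => _ /eqP ->; rewrite mnmE.
Qed.

Lemma degi1 i : degi i 1 = 0%N. Proof. exact: degiC. Qed.

Lemma degiD_le i u v : (degi i (u + v) <= maxn (degi i u) (degi i v))%N.
Proof.
apply/degi_leP => m /msuppD_le; rewrite mem_cat leq_max => /orP[] /(degi_le i) -> //.
by rewrite orbT.
Qed.

Lemma degiM i u v : u != 0 -> v != 0 -> degi i (u * v) = (degi i u + degi i v)%N.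
Proof.
move=> u0 v0; apply/eqP; rewrite eqn_leq; apply/andP; split.
  apply/degi_leP => m /msuppM_ex[m1 [m2 [s1 s2 ->]]].
  by rewrite mnmDE leq_add // degi_le.
have [m1 s1 e1] := degi_ex i u0; have [m2 s2 e2] := degi_ex i v0.
have [|||k1 [k2 [_ _ /eqP d1 /eqP d2 /(degi_le i)]]] :=
  @msuppM_part (fun m => m i == degi i u) (fun m => m i == degi i v) u v.
- by apply: (part_neq0 s1); rewrite e1.
- by apply: (part_neq0 s2); rewrite e2.
- move=> k1 k2 l1 l2 k1s k2s _ _ /eqP e1' /eqP e2' e.
  have := congr1 (fun m : 'X_{1..n} => m i) e; rewrite !mnmDE.
  by have := degi_le i k1s; have := degi_le i k2s; lia.
by rewrite mnmDE d1 d2.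
Qed.

Lemma degiM_le i u v : (degi i (u * v) <= degi i u + degi i v)%N.
Proof.
have [->|u0] := eqVneq u 0; first by rewrite mul0r degi0.
have [->|v0] := eqVneq v 0; first by rewrite mulr0 degi0.
by rewrite degiM.
Qed.

Lemma degi_freeM i u v : degi i u = 0%N -> degi i v = 0%N -> degi i (u * v) = 0%N.
Proof. by move=> u0 v0; apply/eqP; rewrite -leqn0 (leq_trans (degiM_le _ _ _)) // u0 v0. Qed.

Lemma degi_freeD i u v : degi i u = 0%N -> degi i v = 0%N -> degi i (u + v) = 0%N.
Proof. by move=> u0 v0; apply/eqP; rewrite -leqn0 (leq_trans (degiD_le _ _ _)) // u0 v0. Qed.

Lemma degi_freeX i u k : degi i u = 0%N -> degi i (u ^+ k) = 0%N.
Proof.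
by move=> u0; elim: k => [|k IH]; rewrite ?expr0 ?degi1 // exprS degi_freeM.
Qed.

Lemma degiN i v : degi i (- v) = degi i v.
Proof. by rewrite /degi (perm_big _ (msuppN v)). Qed.

Lemma sqfreeP v : square_free_supported v <-> forall i, (degi i v <= 1)%N.
Proof.
split=> [H i|H m mv i]; first by apply/degi_leP => m mv; apply: H.
exact: leq_trans (degi_le i mv) (H i).
Qed.

Lemma mpoly_generated (P : {mpoly L[n]} -> Prop) :
  (forall c, P c%:MP) -> (forall i, P 'X_i) ->
  (forall u v, P u -> P v -> P (u + v)) -> (forall u v, P u -> P v -> P (u * v)) ->
  forall v, P v.
Proof.
move=> PC PX PD PM v; rewrite (mpolyE v).
apply: big_ind => [||m _]; first by rewrite -mpolyC0.
  exact: PD.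
rewrite -mul_mpolyC; apply: (PM); first exact: PC.
rewrite mpolyXE_id; apply: big_ind => [||i _]; first by rewrite -mpolyC1.
  exact: PM.
elim: (m i) => [|k IH]; first by rewrite expr0 -mpolyC1.
by rewrite exprS; apply: PM.
Qed.

End Parts.

(** * Square-free irreducible polynomials are prime *)
Section Primality.
Variables (n : nat) (L : fieldType).
Implicit Types (a b c g u v w : {mpoly L[n]}) (m : 'X_{1..n}).

Definition mpoly_prime g :=
  [/\ g != 0, g \isn't a GRing.unit &
     forall u v, mpoly_divides g (u * v) -> mpoly_divides g u \/ mpoly_divides g v].

Lemma mpoly_divides_mull g u v : mpoly_divides g v -> mpoly_divides g (u * v).
Proof. by case=> w ->; exists (u * w); rewrite mulrA. Qed.

Lemma mpoly_divides_trans a b c :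
  mpoly_divides a b -> mpoly_divides b c -> mpoly_divides a c.
Proof. by move=> [u ->] [v ->]; exists (v * u); rewrite mulrA. Qed.

Lemma degi_dvd i g v : v != 0 -> mpoly_divides g v -> (degi i g <= degi i v)%N.
Proof.
move=> v0 [u e]; move: v0; rewrite e mulf_eq0 negb_or => /andP[u0 g0].
by rewrite degiM // leq_addl.
Qed.

Lemma degi_unit i u : u \is a GRing.unit -> degi i u = 0%N.
Proof.
move=> uu; have u0 : u != 0 by apply: contraTneq uu => ->; rewrite unitr0.
have := degi_dvd i (oner_neq0 _) (ex_intro _ u^-1 (esym (mulVr uu))).
by rewrite degi1 leqn0 => /eqP.
Qed.

Lemma nonunit_msize u : u != 0 -> u \isn't a GRing.unit -> (1 < msize u)%N.
Proof.
move=> u0; apply: contraR; rewrite -leqNgt => /msize1_polyC e.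
move: u0; rewrite e mpolyC_eq0 => c0.
by apply: rmorph_unit; rewrite unitfE.
Qed.

Lemma msizeM_lt u v : u != 0 -> v != 0 -> v \isn't a GRing.unit ->
  (msize u < msize (u * v))%N.
Proof.
move=> u0 v0 /(nonunit_msize v0); rewrite msizeM //.
have : (0 < msize u)%N by rewrite lt0n msize_poly_eq0.
by move: (msize u) (msize v) => x y; lia.
Qed.

Lemma irreducible_factor a : a != 0 -> a \isn't a GRing.unit ->
  exists2 a1, mpoly_irreducible a1 & mpoly_divides a1 a.
Proof.
have [N] := ubnP (msize a); elim: N a => // N IH a; rewrite ltnS => aN a0 au.
have [ai|nai] := EM (mpoly_irreducible a); first by exists a => //; exists 1; rewrite mul1r.
have [[u v] [e uu vu]] :
    exists x, [/\ a = x.1 * x.2, x.1 \isn't a GRing.unit & x.2 \isn't a GRing.unit].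
  apply: contrapT => H; apply: nai; split=> // u v e.
  have [|uu] := boolP (u \is a GRing.unit); first by left.
  have [|vu] := boolP (v \is a GRing.unit); first by right.
  by case: H; exists (u, v).
move: e uu vu a0 aN => /= -> uu vu; rewrite mulf_eq0 negb_or => /andP[u0 v0] aN.
have [a1 irr d] := IH u (leq_trans (msizeM_lt u0 v0 vu) aN) u0 uu.
by exists a1 => //; rewrite mulrC; apply: mpoly_divides_mull.
Qed.

Lemma prime_irreducible g : mpoly_prime g -> mpoly_irreducible g.
Proof.
case=> g0 gu gP; split=> // u v e.
have dg : mpoly_divides g (u * v) by exists 1; rewrite mul1r.
have key x y : g = x * y -> mpoly_divides g x -> y \is a GRing.unit.
  move=> exy [s es]; apply/unitrP; exists s; rewrite [y * s]mulrC.
  suff: s * y = 1 by [].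
  by apply: (mulIf g0); rewrite mul1r mulrAC -es exy.
by case: (gP u v dg) => H; [right; apply: key H|left; apply: key H; rewrite mulrC].
Qed.

Lemma split_var i g : square_free_supported g -> exists a b,
  [/\ g = 'X_i * a + b, degi i a = 0%N, degi i b = 0%N &
      forall j, (degi j a <= degi j g)%N].
Proof.
move=> sf; exists g^`M(i), (part (fun m => m i == 0%N) g).
have da m : m \in msupp g^`M(i) -> m i = 0%N /\ (m + U_(i))%MM \in msupp g.
  rewrite mcoeff_msupp mcoeff_deriv => H.
  have mg : (m + U_(i))%MM \in msupp g.
    by rewrite mcoeff_msupp; apply: contraNneq H => ->; rewrite mul0rn.
  by split=> //; have := sf _ mg i; rewrite mnmDE mnm1E eqxx; lia.
split.
- apply/mpolyP => m; rewrite mcoeffD mcoeff_part [_ * g^`M(i)]mulrC.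
  have [m0|m0] := eqVneq (m i) 0%N.
    rewrite [X in X + _]memN_msupp_eq0 ?add0r //; apply/negP => /msuppM_ex[m1 [m2 []]] _.
    by rewrite msuppX inE => /eqP -> e; move: m0; rewrite e mnmDE mnm1E eqxx addn1.
  have [k em] : exists k, m = (k + U_(i))%MM.
    exists (m - U_(i))%MM; rewrite submK //; apply/mnm_lepP => j; rewrite mnm1E.
    by case: eqP => [<-|//]; rewrite lt0n.
  rewrite addr0 em {2}addmC mcoeffMX mcoeff_deriv; have [->|] := eqVneq g@_(k + U_(i)) 0.
    by rewrite mul0rn.
  by rewrite -mcoeff_msupp => /sf /(_ i); rewrite mnmDE mnm1E eqxx addn1 ltnS leqn0 => /eqP ->.
- by apply/eqP; rewrite -leqn0; apply/degi_leP => m /da[->].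
- by apply/eqP; rewrite -leqn0; apply/degi_leP => m; rewrite msupp_part => /andP[/eqP ->].
move=> j; apply/degi_leP => m /da[_ /(degi_le j)]; rewrite mnmDE; exact/leq_trans/leq_addr.
Qed.

Lemma degiX i j : degi i ('X_j : {mpoly L[n]}) = (i == j).
Proof. by rewrite /degi msuppX big_seq1 mnm1E eq_sym. Qed.

(** Modulo x_i a + b one can replace a x_i by - b. *)
Lemma clear_var i a b c : degi i a = 0%N -> degi i b = 0%N -> exists k c' s,
  a ^+ k * c = c' + s * ('X_i * a + b) /\ degi i c' = 0%N.
Proof.
move=> a0 b0; elim/mpoly_generated: c => [c|j|u v|u v].
- by exists 0%N, c%:MP, 0; rewrite mul1r mul0r addr0 degiC.
- have [->|ji] := eqVneq j i.
    by exists 1%N, (- b), 1; rewrite degiN expr1; split=> //; ring.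
  by exists 0%N, 'X_j, 0; rewrite mul1r mul0r addr0 degiX eq_sym (negPf ji).
- move=> [k [u' [s [eu u0]]]] [l [v' [t [ev v0]]]].
  exists (k + l)%N, (a ^+ l * u' + a ^+ k * v'), (a ^+ l * s + a ^+ k * t).
  split; last by apply: degi_freeD; apply: degi_freeM => //; apply: degi_freeX.
  transitivity (a ^+ l * (a ^+ k * u) + a ^+ k * (a ^+ l * v)); first by rewrite exprD; ring.
  by rewrite eu ev; ring.
move=> [k [u' [s [eu u0]]]] [l [v' [t [ev v0]]]].
exists (k + l)%N, (u' * v'), (u' * t + s * v' + s * t * ('X_i * a + b)).
split; last exact: degi_freeM.
transitivity ((a ^+ k * u) * (a ^+ l * v)); first by rewrite exprD; ring.
by rewrite eu ev; ring.
Qed.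

Lemma sqfree_dvd a1 a : a != 0 -> square_free_supported a -> mpoly_divides a1 a ->
  square_free_supported a1.
Proof.
move=> a0 /sqfreeP sf d; apply/sqfreeP => i; exact: leq_trans (degi_dvd i a0 d) (sf i).
Qed.

(** The irreducible factors of a can be cancelled one after the other: each of them
    divides w * b but, by coprimality, not b, so that it divides w. *)
Lemma coprime_cancel a b w : a != 0 ->
  (forall a1, mpoly_divides a1 a -> mpoly_irreducible a1 -> mpoly_prime a1) ->
  (forall s, mpoly_divides s a -> mpoly_divides s b -> s \is a GRing.unit) ->
  mpoly_divides a (w * b) -> mpoly_divides a w.
Proof.
have [N] := ubnP (msize a); elim: N a w => // N IH a w; rewrite ltnS => aN a0 aP co.
have [au|au] := boolP (a \is a GRing.unit).
  by move=> _; exists (w * a^-1); rewrite divrK.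
have [a1 irr d1] := irreducible_factor a0 au; have pr1 := aP _ d1 irr.
have [a2 e] := d1 => dw; have [a10 a1u P1] := pr1.
have a20 : a2 != 0 by move: a0; rewrite e mulf_eq0 negb_or => /andP[].
have [[w1 ew]|db] := P1 w b (mpoly_divides_trans d1 dw); last first.
  by move: a1u; rewrite co.
have d2 : mpoly_divides a2 a by exists a1; rewrite e mulrC.
have [|||||w2 ew2] := IH a2 w1; rewrite ?ew //.
- by apply: leq_trans aN; rewrite e; apply: msizeM_lt.
- by move=> x dx; apply: aP; apply: mpoly_divides_trans d2.
- by move=> s ds; apply: co; apply: mpoly_divides_trans d2.
- by have [z ez] := dw; exists z; apply: (mulIf a10); transitivity (w * b); [rewrite ew; ring | rewrite ez e; ring].
by exists w2; rewrite ew2 e mulrA.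
Qed.

(** Induction on the number of variables that occur in g = x_i a + b.  The polynomials
    a and b are coprime, since g is irreducible, and a involves fewer variables, so
    that a can be cancelled in multiples of g by coprime_cancel.  Hence the factors
    of a multiple of g may be assumed to be free of x_i, and then their product is a
    multiple of g of degree 0 in x_i, that is, zero. *)
Lemma sqfree_irreducible_prime g :
  square_free_supported g -> mpoly_irreducible g -> mpoly_prime g.
Proof.
have [N] := ubnP #|[set i | degi i g != 0%N]|.
elim: N g => // N IH g; rewrite ltnS => gN sf irr; have [g0 gu gI] := irr.
split=> // u v [x ex].
have [i gi] : exists i, degi i g != 0%N.
  apply: contrapT => H;
  have e : g = (g@_0)%:MP.
    apply/mpolyP => m; rewrite mcoeffC; case: eqP => [->|m0]; first by rewrite mulr1.
    rewrite mulr0; apply/memN_msupp_eq0/negP => mg; apply: m0; apply/mnmP => i.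
    rewrite mnm0E; apply/eqP; apply: contrapT => /negP mi; apply: H; exists i.
    by apply: contra_neq mi => gi; apply: degi0P gi mg.
  move: g0 gu; rewrite e mpolyC_eq0 => c0; case/negP.
  by apply: rmorph_unit; rewrite unitfE.
have [a [b [eg ai bi aj]]] := split_var i sf.
have a0 : a != 0.
  by apply: contra_neq gi => a0; rewrite eg a0 mulr0 add0r.
have ngfree c : degi i c = 0%N -> mpoly_divides g c -> c = 0.
  move=> ci dc; apply/eqP; apply: contraNT gi => c0; have := degi_dvd i c0 dc.
  by rewrite ci leqn0.
have sfa : square_free_supported a.
  by apply/sqfreeP => j; apply: leq_trans (aj j) _; have /sqfreeP := sf.
have cancel c : mpoly_divides g (a * c) -> mpoly_divides g c.
  move=> [s es]; have [|||s' es'] := @coprime_cancel a b s a0.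
  - move=> a1 d1 irr1; apply: IH => //; last exact: sqfree_dvd d1.
    apply: leq_trans gN; apply: proper_card; apply/properP; split.
      apply/subsetP => j; rewrite !inE; apply: contra => /eqP gj.
      by have := leq_trans (degi_dvd j a0 d1) (aj j); rewrite gj leqn0.
    exists i; rewrite !inE //; have := degi_dvd i a0 d1; rewrite ai leqn0 => /eqP ->.
    by rewrite eqxx.
  - move=> t [t1 et1] [t2 et2].
    have et : g = ('X_i * t1 + t2) * t by rewrite eg et1 et2; ring.
    have [tu|//] := gI _ _ et; case/negP: a0; apply/eqP; apply: ngfree => //.
    exists (t1 * ('X_i * t1 + t2)^-1); rewrite et et1 mulrA.
    by rewrite divrK.
  - by exists (c - s * 'X_i); transitivity (s * g - s * ('X_i * a)); [rewrite eg; ring|rewrite -es; ring].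
  by exists s'; apply: (mulfI a0); rewrite es es'; ring.
have cancelX k c : mpoly_divides g (a ^+ k * c) -> mpoly_divides g c.
  elim: k => [|k IHk]; first by rewrite mul1r.
  by rewrite exprS -mulrA => /cancel.
have [k [u' [s [eu u0]]]] := clear_var u ai bi.
have [l [v' [t [ev v0]]]] := clear_var v ai bi.
rewrite -eg in eu ev.
have : u' * v' = 0.
  apply: ngfree; first exact: degi_freeM.
  have -> : u' = a ^+ k * u - s * g by rewrite eu; ring.
  have -> : v' = a ^+ l * v - t * g by rewrite ev; ring.
  exists (a ^+ k * a ^+ l * x - s * (a ^+ l * v) - t * (a ^+ k * u) + s * t * g).
  by transitivity (a ^+ k * a ^+ l * (u * v) - (s * (a ^+ l * v) + t * (a ^+ k * u) - s * t * g) * g);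
    [ring|rewrite ex; ring].
move/eqP; rewrite mulf_eq0 => /orP[] /eqP e0.
  by left; apply: (cancelX k); exists s; rewrite eu e0 add0r.
by right; apply: (cancelX l); exists t; rewrite ev e0 add0r.
Qed.

End Primality.

(** * Extension of the field of coefficients *)
Section Descent.
Variables (n : nat) (K L : fieldType) (iota : {rmorphism K -> L}).
Implicit Types (f g h : {mpoly K[n]}) (u v : {mpoly L[n]}).

Lemma mem_msupp_map f m : (m \in msupp (map_mpoly iota f)) = (m \in msupp f).
Proof. by rewrite !mcoeff_msupp mcoeff_map_mpoly fmorph_eq0. Qed.

Lemma map_mpoly_inj : injective (map_mpoly iota : {mpoly K[n]} -> {mpoly L[n]}).
Proof.
move=> f g /mpolyP e; apply/mpolyP => m; apply: (fmorph_inj iota).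
by have := e m; rewrite !mcoeff_map_mpoly.
Qed.

Lemma sqfree_map f : square_free_supported f -> square_free_supported (map_mpoly iota f).
Proof. by move=> sf m; rewrite mem_msupp_map => /sf. Qed.

Lemma dhomog_map k f : f \is k.-homog -> map_mpoly iota f \is k.-homog.
Proof. by move=> hf; apply/dhomogP => m; rewrite mem_msupp_map => /(dhomog_mf hf). Qed.

(** As u and v have no variable in common, the coefficient of u * v at m + m2 is the
    product of those of u at m and of v at m2, so that u is determined up to the
    scalar v@_m2 by coefficients in K. *)
Lemma factor_descent f u v m2 : square_free_supported f ->
  map_mpoly iota f = u * v -> m2 \in msupp v ->
  exists u0 : {mpoly K[n]}, map_mpoly iota u0 = v@_m2 *: u.
Proof.
move=> sf e m2v; have [->|u0] := eqVneq u 0; first by exists 0; rewrite rmorph0 scaler0.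
have v0 : v != 0 by apply: contraTneq m2v => ->; rewrite msupp0.
have free i : degi i u = 0%N \/ degi i v = 0%N.
  have /sqfreeP /(_ i) := sqfree_map sf; rewrite e degiM //.
  by case: (degi i u) (degi i v) => [|x] [|y]; [left|left|right|rewrite addnS].
exists (\sum_(m <- msupp u) f@_(m + m2) *: 'X_[m]); apply/mpolyP => m.
rewrite mcoeff_map_mpoly mcoeffZ raddf_sum /= rmorph_sum /=.
under eq_bigr => k _ do rewrite mcoeffZ mcoeffX rmorphM rmorph_nat.
have [mu|mu] := boolP (m \in msupp u); last first.
  rewrite (memN_msupp_eq0 mu) mulr0 big_seq big1 // => k ku.
  by have -> : (k == m) = false; [apply: contraNF mu => /eqP <-|rewrite mulr0].
rewrite (bigD1_seq m) ?msupp_uniq //= eqxx mulr1 big1 ?addr0; last first.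
  by move=> k /negPf ->; rewrite mulr0.
rewrite mulrC -mcoeff_map_mpoly e mcoeffM_uniq // => k k' ku kv ek.
have {}ek i : (m i + m2 i = k i + k' i)%N.
  by have := congr1 (fun m : 'X_{1..n} => m i) ek; rewrite !mnmDE.
have d i : m i = k i /\ m2 i = k' i.
  have := ek i; case: (free i) => z.
    by rewrite (degi0P z mu) (degi0P z ku).
  by rewrite (degi0P z m2v) (degi0P z kv) !addn0.
by split; apply/mnmP => i; have [] := d i.
Qed.

(** Both factors over L are proportional to polynomials over K; the constant c by
    which the product of these differs from g is the quotient of two coefficients
    in K, so that g factors in the same way over K. *)
Lemma sqfree_irreducible_map g : square_free_supported g -> mpoly_irreducible g ->
  mpoly_irreducible (map_mpoly iota g).
Proof.
move=> sf [g0 gu irr].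
have mu h : map_mpoly iota h \is a GRing.unit -> h \is a GRing.unit.
  move=> hu; have c : h = (h@_0)%:MP.
    apply/mpolyP => m; rewrite mcoeffC; case: eqP => [->|/eqP m0]; first by rewrite mulr1.
    rewrite mulr0; apply/memN_msupp_eq0/negP => mh; move/eqP: m0; apply; apply/mnmP => i.
    rewrite mnm0E; apply: degi0P (degi_unit i hu) _; by rewrite mem_msupp_map.
  rewrite c; apply: rmorph_unit; rewrite unitfE.
  by apply: contraTneq hu => h0; rewrite c h0 mpolyC0 rmorph0 unitr0.
split=> [||u v e].
- by rewrite -(rmorph0 (map_mpoly iota)) (inj_eq map_mpoly_inj).
- by apply: contra gu; apply: mu.
have : map_mpoly iota g != 0 by rewrite -(rmorph0 (map_mpoly iota)) (inj_eq map_mpoly_inj).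
rewrite e mulf_eq0 negb_or => /andP[u0 v0].
have [m1 m1u] := ex_msupp u0; have [m2 m2v] := ex_msupp v0.
have [u1 eu] := factor_descent sf e m2v.
have [v1 ev] := factor_descent sf (etrans e (mulrC _ _)) m1u.
have nz1 : u@_m1 != 0 by rewrite -mcoeff_msupp.
have nz2 : v@_m2 != 0 by rewrite -mcoeff_msupp.
have uvE : map_mpoly iota (u1 * v1) = (v@_m2 * u@_m1) *: map_mpoly iota g.
  by rewrite rmorphM /= eu ev e -scalerAl -scalerAr scalerA.
have [mg mgg] := ex_msupp g0.
pose c := (u1 * v1)@_mg / g@_mg.
have cE : iota c = v@_m2 * u@_m1.
  have := congr1 (mcoeff mg) uvE; rewrite mcoeffZ !mcoeff_map_mpoly /c fmorph_div => ->.
  by rewrite mulfK // fmorph_eq0 -mcoeff_msupp.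
have c0 : c != 0 by rewrite -(fmorph_eq0 iota) cE mulf_neq0.
have {}uvE : u1 * v1 = c *: g.
  by apply: map_mpoly_inj; rewrite uvE map_mpolyZ cE.
have unitZ (F : fieldType) (x : F) (w : {mpoly F[n]}) :
    x != 0 -> x *: w \is a GRing.unit -> w \is a GRing.unit.
  move=> x0 xw; rewrite -[w]scale1r -(mulVf x0) -scalerA -mul_mpolyC unitrM xw andbT.
  by apply: rmorph_unit; rewrite unitfE invr_eq0.
have [|vu|vu] := irr (c^-1 *: u1) v1.
- by rewrite -scalerAl uvE scalerA mulVf // scale1r.
- left; apply: (unitZ _ _ _ nz2); rewrite -eu; apply: rmorph_unit.
  by apply: unitZ vu; rewrite invr_eq0.
by right; apply: (unitZ _ _ _ nz1); rewrite -ev; apply: rmorph_unit.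
Qed.

Lemma sqfree_divides_map g h : g != 0 -> square_free_supported h ->
  mpoly_divides (map_mpoly iota g) (map_mpoly iota h) -> mpoly_divides g h.
Proof.
move=> g0 sf [u e].
have [m2 m2g] := ex_msupp g0.
have [|u0 eu] := factor_descent sf e (m2 := m2); first by rewrite mem_msupp_map.
have nz : g@_m2 != 0 by rewrite -mcoeff_msupp.
exists ((g@_m2)^-1 *: u0); apply: map_mpoly_inj.
rewrite rmorphM /= map_mpolyZ eu mcoeff_map_mpoly scalerA -rmorphM mulVf //.
by rewrite rmorph1 scale1r.
Qed.

End Descent.

(** * Monomials with exponents below a power of p *)
Section Frobenius.
Variables (p : nat) (R : comNzRingType) (pR : p \in [pchar R]).

Lemma frobenius_iter e : exists F : {rmorphism R -> R}, forall x, F x = x ^+ (p ^ e).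
Proof.
elim: e => [|e [F FE]]; first by exists idfun => x; rewrite expn0 expr1.
exists (pFrobenius_aut pR \o F) => x.
by rewrite /= FE pFrobenius_autE -exprM expnSr.
Qed.

End Frobenius.

(** All binomial coefficients C(q - 1, i) are 1 or - 1 modulo p.  The formula results
    from cancelling x + y in x^q - (- y)^q = (x + y)^q. *)
Lemma addX_pred (p : nat) (R : idomainType) (pR : p \in [pchar R]) e (x y : R) :
  x + y != 0 ->
  (x + y) ^+ (p ^ e).-1 = \sum_(i < p ^ e) x ^+ ((p ^ e).-1 - i) * (- y) ^+ i.
Proof.
move=> xy; have [F FE] := frobenius_iter pR e.
have q0 : (0 < p ^ e)%N by rewrite expn_gt0 prime_gt0 // (pcharf_prime pR).
apply: (mulfI xy); rewrite -exprS prednK // -FE rmorphD !FE.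
by rewrite -{2}(opprK y) -subrXX -(FE (- y)) rmorphN opprK FE.
Qed.

Section Low.
Variables (p n : nat) (L : fieldType) (pL : p \in [pchar L]).
Implicit Types (u v w c g : {mpoly L[n]}) (m : 'X_{1..n}) (S : {set 'I_n}).

Let p_prime : prime p := pcharf_prime pL.

Lemma pchar_mpoly : p \in [pchar {mpoly L[n]}].
Proof. by rewrite (rmorph_pchar (@mpolyC n L)). Qed.

Lemma q_gt0 e : (0 < p ^ e)%N.
Proof. by rewrite expn_gt0 prime_gt0. Qed.

Lemma frobeniusE e w :
  w ^+ (p ^ e) = \sum_(m <- msupp w) w@_m ^+ (p ^ e) *: 'X_[m *+ p ^ e].
Proof.
have [F FE] := frobenius_iter pchar_mpoly e.
rewrite -FE {1}(mpolyE w) rmorph_sum; apply: eq_bigr => m _.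
by rewrite /= FE exprZn mpolyXn.
Qed.

Lemma mulm_inj q : (0 < q)%N -> injective (fun m => m *+ q)%MM.
Proof.
move=> q0 m m' /mnmP e; apply/mnmP => i; have := e i; rewrite !mulmnE => /eqP.
by rewrite eqn_pmul2r // => /eqP.
Qed.

Lemma mcoeff_frobenius e w m : (w ^+ (p ^ e))@_(m *+ p ^ e) = w@_m ^+ (p ^ e).
Proof.
have E k : 'X_[L, k *+ p ^ e]@_(m *+ p ^ e) = (k == m)%:R.
  by rewrite mcoeffX (inj_eq (mulm_inj (q_gt0 e))).
rewrite frobeniusE raddf_sum /=.
under eq_bigr => k _ do rewrite mcoeffZ E.
have [mw|mw] := boolP (m \in msupp w).
  rewrite (bigD1_seq m) ?msupp_uniq //= eqxx mulr1 big1 ?addr0 // => k /negPf ->.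
  by rewrite mulr0.
rewrite (memN_msupp_eq0 mw) expr0n (gtn_eqF (q_gt0 e)) big_seq big1 // => k kw.
by have -> : (k == m) = false; [apply: contraNF mw => /eqP <-|rewrite mulr0].
Qed.

Lemma msupp_frobenius e w m : m \in msupp (w ^+ (p ^ e)) ->
  exists2 m0, m0 \in msupp w & m = (m0 *+ p ^ e)%MM.
Proof.
rewrite frobeniusE mcoeff_msupp raddf_sum /= => H; apply: contrapT => nex.
case/negP: H; rewrite big_seq big1 // => k kw; rewrite mcoeffZ mcoeffX.
by case: eqP => [e0|]; rewrite ?mulr0 //; case: nex; exists k.
Qed.

(** The negation of low S q v says that v lies in the ideal generated by the powers
    x_i^q with i in S. *)
Definition low S q v := exists2 m, m \in msupp v & forall i, i \in S -> (m i < q)%N.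

Lemma low_mull S q u v : low S q (u * v) -> low S q v.
Proof.
case=> m /msuppM_ex[m1 [m2 [_ m2v ->]]] lo; exists m2 => // i iS.
by apply: leq_ltn_trans (lo i iS); rewrite mnmDE leq_addl.
Qed.

Lemma low_sum S q k (F : 'I_k -> {mpoly L[n]}) :
  low S q (\sum_(j < k) F j) -> exists j, low S q (F j).
Proof.
case=> m; rewrite mcoeff_msupp raddf_sum => H lo; apply: contrapT => nex.
case/negP: H; rewrite /= big1 // => j _; apply/memN_msupp_eq0/negP => mj.
by apply: nex; exists j; exists m.
Qed.

Lemma mnm_le_mdeg m i : (m i <= mdeg m)%N.
Proof. by rewrite mdegE (bigD1 i) //= leq_addr. Qed.

Lemma low_ex v N : v != 0 -> exists2 e, (N <= e)%N & low setT (p ^ e) v.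
Proof.
move=> v0; have [m mv] := ex_msupp v0; exists (N + mdeg m)%N; first exact: leq_addr.
exists m => // i _; apply: leq_ltn_trans (mnm_le_mdeg m i) _.
apply: leq_trans (ltn_expl _ (prime_gt1 p_prime)) _.
by rewrite leq_pexp2l ?prime_gt0 // leq_addl.
Qed.

Lemma low_sub S S' q v : S \subset S' -> low S' q v -> low S q v.
Proof. by move=> /subsetP s [m mv lo]; exists m => // i /s /lo. Qed.

(** This is the flatness of the Frobenius map: the ideal generated by the
    x_i^(q * p^e) has colon by w^(p^e) the Frobenius power of its colon by w.
    Concretely, let b be a low monomial of w, minimal for the sum of its exponents in
    S, and k a low monomial of c.  A product k' + p^e d of monomials of c and of
    w^(p^e) that agrees with k + p^e b on S satisfies d <= b on S, as the exponents
    of k are smaller than p^e, and then d = b on S by minimality. *)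
Lemma low_mul_frobenius S q e c w : low S q w -> low S (p ^ e) c ->
  low S (q * p ^ e) (c * w ^+ (p ^ e)).
Proof.
move=> [b0 b0w b0lo] [k kc klo]; set Q := (p ^ e)%N.
pose lows := [seq m : 'X_{1..n} <- msupp w | [forall (i | i \in S), m i < q]%N].
have lows0 : lows != [::].
  have : b0 \in lows by rewrite mem_filter b0w andbT; apply/forall_inP.
  by case: lows.
have [b] := seq_argmin (fun m : 'X_{1..n} => \sum_(i in S) m i)%N lows0.
rewrite mem_filter => /andP[/forall_inP blo bw] bmin.
have Q0 : (0 < Q)%N := q_gt0 e.
have [|||m1 [m2 [_ _ /forall_inP P1 /forall_inP P2 ms]]] :=
  @msuppM_part n L (fun m : 'X_{1..n} => [forall (i | i \in S), m i == k i])
    (fun m : 'X_{1..n} => [forall (i | i \in S), m i == b i * Q]%N) c (w ^+ Q).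
- by apply: (part_neq0 kc); apply/forall_inP.
- apply: (@part_neq0 _ _ _ _ (b *+ Q)%MM).
    by rewrite mcoeff_msupp mcoeff_frobenius expf_neq0 // -mcoeff_msupp.
  by apply/forall_inP => i _; rewrite mulmnE.
- move=> m1 m2 m1' m2' m1c /msupp_frobenius[d dw ->] _ _ /forall_inP P1 /forall_inP P2.
  move=> /mnmP em; have {}em i : i \in S -> (k i + b i * Q = m1 i + d i * Q)%N.
    move=> iS; have := em i; rewrite !mnmDE mulmnE.
    by rewrite (eqP (P1 i iS)) (eqP (P2 i iS)).
  have db i : i \in S -> (d i <= b i)%N.
    move=> iS; rewrite leqNgt; apply/negP => lt; have := em i iS; have := klo i iS.
    by have := leq_mul lt (leqnn Q); rewrite mulSn -/Q; lia.
  have dlow : d \in lows.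
    rewrite mem_filter dw andbT; apply/forall_inP => i iS.
    exact: leq_ltn_trans (db i iS) (blo i iS).
  have eqdb i : i \in S -> d i = b i.
    have s0 : (\sum_(i in S) (b i - d i) = 0)%N.
      by rewrite sumnB //; apply/eqP; rewrite subn_eq0 bmin.
    move=> iS; apply/eqP; rewrite eqn_leq db //=.
    by move/eqP: s0; rewrite sum_nat_eq0 => /forall_inP/(_ i iS); rewrite subn_eq0.
  apply/andP; split; apply/forall_inP => i iS; last by rewrite mulmnE eqdb.
  by have := em i iS; rewrite eqdb // => /eqP; rewrite eqn_add2r eq_sym.
exists (m1 + m2)%MM => // i iS; rewrite mnmDE (eqP (P1 i iS)) (eqP (P2 i iS)).
apply: (@leq_trans ((b i).+1 * Q)); last by rewrite leq_mul2r blo ?orbT.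
by rewrite mulSn ltn_add2r klo.
Qed.

End Low.

(** * F-regularity of square-free primes at the origin *)
Section SquareFreeLow.
Variables (p n : nat) (L : fieldType) (pL : p \in [pchar L]).
Implicit Types (a b c g u v w : {mpoly L[n]}) (m : 'X_{1..n}) (S : {set 'I_n}).

Lemma mpoly_divides_sum g k (F : 'I_k -> {mpoly L[n]}) :
  (forall j, mpoly_divides g (F j)) -> mpoly_divides g (\sum_(j < k) F j).
Proof.
move=> H; apply: big_ind => // [|_ _ [u ->] [v ->]]; first by exists 0; rewrite mul0r.
by exists (u + v); rewrite mulrDl.
Qed.

Lemma part_decomp i c :
  c = \sum_(k < (degi i c).+1) part (fun m : 'X_{1..n} => m i == k) c.
Proof.
apply/mpolyP => m; rewrite raddf_sum /=.
under eq_bigr => k _ do rewrite mcoeff_part.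
have [mc|mc] := boolP (m \in msupp c); last first.
  by rewrite (memN_msupp_eq0 mc) big1 // => k _; rewrite if_same.
have lt : (m i < (degi i c).+1)%N by rewrite ltnS degi_le.
rewrite (bigD1 (Ordinal lt)) //= eqxx big1 ?addr0 // => k.
by rewrite eq_sym -val_eqE /= => /negPf ->.
Qed.

Lemma part_predT c : part predT c = c.
Proof. by apply/mpolyP => m; rewrite mcoeff_part. Qed.

(** The case where g is a unit in the localization at the ideal generated by the
    variables in S. *)
Lemma low_unit S g c N : low S 1 g -> c != 0 ->
  exists2 e, (N <= e)%N & low S (p ^ e) (c * g ^+ (p ^ e).-1).
Proof.
move=> g1 c0; have [e Ne cl] := low_ex pL N c0; exists e => //.
have := low_mul_frobenius pL g1 (low_sub (subsetT S) cl); rewrite mul1n.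
by rewrite -{2}(prednK (q_gt0 pL e)) exprS mulrCA => /low_mull.
Qed.

(** If x_i does not occur in g, then the exponent of x_i comes from c alone: the
    induction hypothesis is applied to a coefficient of c with respect to x_i, and to
    a power of p that exceeds the exponent of x_i at this place. *)
Lemma low_free S i g c N : i \in S -> degi i g = 0%N -> ~ mpoly_divides g c ->
  (forall c N, ~ mpoly_divides g c ->
     exists2 e, (N <= e)%N & low (S :\ i) (p ^ e) (c * g ^+ (p ^ e).-1)) ->
  exists2 e, (N <= e)%N & low S (p ^ e) (c * g ^+ (p ^ e).-1).
Proof.
move=> iS gi gc IH.
have [k gk] : exists k : nat, ~ mpoly_divides g (part (fun m : 'X_{1..n} => m i == k) c).
  apply: contrapT => H; apply: gc; rewrite (part_decomp i c); apply: mpoly_divides_sum => k.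
  by apply: contrapT => H'; apply: H; exists k.
have [e Ne [m ms mlo]] := IH _ (maxn N k) gk.
move: Ne; rewrite geq_max => /andP[Ne ke]; exists e => //.
have Gi : degi i (g ^+ (p ^ e).-1) = 0%N by apply: degi_freeX.
have mi : m i = k.
  have [m1 [m2 []]] := msuppM_ex ms; rewrite msupp_part => /andP[/eqP m1k _] m2s ->.
  by rewrite mnmDE m1k (degi0P Gi m2s) addn0.
exists m.
  rewrite mcoeff_msupp (@mcoeffM_part _ _ (fun m : 'X_{1..n} => m i == k) predT).
    by rewrite part_predT -mcoeff_msupp.
  move=> m1 m2 _ m2s em; rewrite andbT -mi em mnmDE (degi0P Gi m2s) addn0.
  by rewrite eqxx.
move=> j jS; have [->|ji] := eqVneq j i; last by apply: mlo; rewrite !inE ji.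
rewrite mi; apply: leq_ltn_trans ke _; apply: ltn_expl.
exact: prime_gt1 (pcharf_prime pL).
Qed.

(** The terms of the binomial expansion of ('X_i * a + b) ^+ q.-1 have different
    degrees in x_i, hence cannot cancel each other, and these degrees are all
    smaller than q. *)
Lemma low_addX S i a b c J q : degi i a = 0%N -> degi i b = 0%N -> degi i c = 0%N ->
  'X_i * a + b != 0 -> (exists e, q = p ^ e)%N ->
  (J < q)%N -> low (S :\ i) q (c * (a ^+ J * b ^+ (q.-1 - J))) ->
  low S q (c * ('X_i * a + b) ^+ q.-1).
Proof.
move=> ai bi ci nz [e ->] Jq; pose t l := (-1) ^+ l * (c * (a ^+ l * b ^+ ((p ^ e).-1 - l))).
have tfree l : degi i (t l) = 0%N.
  by do ?[apply: degi_freeM => //|apply: degi_freeX => //]; rewrite degiN degi1.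
have tE l m : (t l)@_m = (-1) ^+ l * (c * (a ^+ l * b ^+ ((p ^ e).-1 - l)))@_m.
  rewrite /t -[in LHS]signr_odd -[in RHS]signr_odd.
  by case: (odd l); rewrite ?mul1r // !mulN1r mcoeffN.
move=> [m mt mlo].
have {}mt : m \in msupp (t J).
  by rewrite mcoeff_msupp tE mulf_eq0 signr_eq0 -mcoeff_msupp.
have mi : m i = 0%N := degi0P (tfree J) mt.
have eqs : c * ('X_i * a + b) ^+ (p ^ e).-1 =
    \sum_(l < p ^ e) t l * 'X_[U_(i) *+ l].
  rewrite addrC (addX_pred (pchar_mpoly n pL)) 1?addrC // mulr_sumr; apply: eq_bigr => l _.
  rewrite /t -mpolyXn [(- (_ * a)) ^+ _]exprNn exprMn.
  by move: ('X_i ^+ l) (a ^+ l) (b ^+ _) ((-1) ^+ l) => x1 x2 x3 x4; ring.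
exists (U_(i) *+ J + m)%MM.
  rewrite mcoeff_msupp eqs raddf_sum /= (bigD1 (Ordinal Jq)) //= mcoeffMX.
  rewrite big1 ?addr0 -?mcoeff_msupp // => l lJ; apply/memN_msupp_eq0/negP.
  move=> /msuppM_ex[m1 [m2 [m1t]]]; rewrite msuppX inE => /eqP -> /mnmP/(_ i).
  rewrite !mnmDE !mulmnE !mnm1E eqxx mi (degi0P (tfree l) m1t) !mul1n addn0 add0n => e1.
  by move: lJ; rewrite -val_eqE /= -e1 eqxx.
move=> j jS; rewrite mnmDE mulmnE mnm1E eq_sym.
have [->|ji] := eqVneq j i; first by rewrite mul1n mi addn0.
by rewrite mul0n add0n; apply: mlo; rewrite !inE ji.
Qed.

(** Induction on S.  That e can be taken arbitrarily large is what makes the induction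
    pass a variable that does not occur in g, see low_free. *)
Lemma sqfree_prime_low S g : square_free_supported g -> mpoly_prime g ->
  forall c N, ~ mpoly_divides g c ->
  exists2 e, (N <= e)%N & low S (p ^ e) (c * g ^+ (p ^ e).-1).
Proof.
move=> sf [g0 gu gP]; have [N] := ubnP #|S|; elim: N S => // N0 IH S; rewrite ltnS => SN.
move=> c N gc.
have c0 : c != 0 by apply/eqP => c0; apply: gc; exists 0; rewrite c0 mul0r.
have [S0|[i iS]] := set_0Vmem S.
  exists N => //; have [m ms] : exists m, m \in msupp (c * g ^+ (p ^ N).-1).
    by apply: ex_msupp; rewrite mulf_neq0 // expf_neq0.
  by exists m => // i; rewrite S0 inE.
have {}IH : forall c N, ~ mpoly_divides g c ->
     exists2 e, (N <= e)%N & low (S :\ i) (p ^ e) (c * g ^+ (p ^ e).-1).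
  by apply: IH; rewrite (cardsD1 i) iS in SN.
have [g1|ng1] := EM (low S 1 g); first exact: low_unit.
have [a [b [eg ai bi _]]] := split_var i sf.
have [a0|a0] := eqVneq a 0.
  have gi : degi i g = 0%N by rewrite eg a0 mulr0 add0r.
  exact: (@low_free S i g c N iS gi gc IH).
(* The induction hypothesis for a says that the ideal (a, b) has a power, of exponent
   q0, that is not contained in the ideal of the x_k^q0 with k in S :\ i. *)
have ga : ~ mpoly_divides g a.
  move=> /(degi_dvd i a0); rewrite ai leqn0 => /eqP gi.
  have : degi i ('X_i * a) = 0%N.
    have -> : 'X_i * a = g + - b by rewrite eg; ring.
    by apply: degi_freeD => //; rewrite degiN.
  rewrite degiM ?ai ?degiX ?eqxx // .
  by apply/eqP => X0; have := degiX L i i; rewrite X0 degi0 eqxx.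
have [e0 _] := IH a 0%N ga; set q0 := (p ^ e0)%N => lo0.
have [j jlo] : exists j : 'I_q0, low (S :\ i) q0 (a ^+ j.+1 * b ^+ (q0.-1 - j)).
  move: lo0; rewrite eg [_ + b]addrC (addX_pred (pchar_mpoly n pL)); last by rewrite addrC -eg.
  rewrite mulr_sumr => /low_sum[j] H; exists j; move: H.
  have -> : a * (b ^+ (q0.-1 - j) * (- ('X_i * a)) ^+ j) =
            (- 'X_i) ^+ j * (a ^+ j.+1 * b ^+ (q0.-1 - j)).
    by rewrite -mulNr exprMn exprS; ring.
  exact: low_mull.
have [k [c' [s [ec ci]]]] := clear_var c ai bi; rewrite -eg in ec.
have c'0 : c' != 0.
  apply/eqP => c'0; have : mpoly_divides g (a ^+ k * c) by exists s; rewrite ec c'0 add0r.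
  elim: k {ec} => [|k IHk]; first by rewrite mul1r.
  by rewrite exprS -mulrA => /gP[].
have [e1 Ne1 clo] := low_ex pL N c'0; set q1 := (p ^ e1)%N in clo.
have q1_gt0 : (0 < q1)%N := q_gt0 pL e1.
(* one factor a is given up, to arrive at q - 1 factors a or b *)
pose J := (j.+1 * q1).-1.
have jq : (j.+1 * q1 <= q0 * q1)%N by rewrite leq_mul2r ltn_ord orbT.
have JE : J.+1 = (j.+1 * q1)%N by rewrite prednK // muln_gt0.
have lo1 : low (S :\ i) (q0 * q1) (c' * (a ^+ J * b ^+ ((q0 * q1).-1 - J))).
  have := low_mul_frobenius pL jlo (low_sub (subsetT _) clo); rewrite -/q1.
  rewrite exprMn -!exprM -JE exprS -mulrA [c' * (a * _)]mulrCA => /low_mull.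
  suff -> : ((q0.-1 - j) * q1 = (q0 * q1).-1 - J)%N by [].
  have -> : (q0.-1 - j = q0 - j.+1)%N by rewrite -subn1 -subnDA add1n.
  by rewrite mulnBl -JE subnS -predn_sub.
have qE : (q0 * q1 = p ^ (e0 + e1))%N by rewrite expnD.
exists (e0 + e1)%N; first by rewrite (leq_trans Ne1) // leq_addl.
rewrite -qE; have [||||m] := @low_addX S i a b c' J (q0 * q1)%N ai bi ci; rewrite -?eg //.
- by exists (e0 + e1)%N.
- by rewrite JE.
have -> : c' = a ^+ k * c - s * g by rewrite ec; ring.
rewrite mulrBl => /msuppB_le; rewrite mem_cat => /orP[] ms mlo.
  by apply: (@low_mull _ _ _ _ (a ^+ k)); exists m; rewrite ?mulrA.
(* a multiple of g^q can have a low monomial only if g has one without any x_i in S *)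
case: ng1; move: ms; rewrite -mulrA -exprS prednK ?muln_gt0 ?q1_gt0 ?(q_gt0 pL) // qE.
move=> /msuppM_ex[m1 [m2 [_ /(msupp_frobenius pL)[m3 m3g ->] em]]]; exists m3 => // l lS.
have := mlo l lS; rewrite em mnmDE mulmnE qE ltnS leqn0.
by case: (m3 l) => // z; rewrite mulSn; lia.
Qed.

End SquareFreeLow.

(** * The polynomial g + t *)
Lemma addn_extremal (x y x' y' : nat) : (x' + y' = x + y)%N ->
  (x <= x')%N && (y <= y')%N || (x' <= x)%N && (y' <= y)%N -> x = x' /\ y = y'.
Proof. by lia. Qed.

Section Homogeneous.
Variables (n D : nat) (L : fieldType) (v : {mpoly L[n]}).
Hypothesis v_homog : v \is D.-homog.

Lemma homog_mdeg m : m \in msupp v -> mdeg m = D.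
Proof. by move/(dhomog_mf v_homog). Qed.

Lemma homog_mcoeff0 m : mdeg m != D -> v@_m = 0.
Proof. exact: (dhomog_nemf_coeff v_homog). Qed.

End Homogeneous.

Section Deformation.
Variables (n d : nat) (L : fieldType).
Variables (g t : {mpoly L[n]}).
Hypotheses (g_sqfree : square_free_supported g) (g_prime : mpoly_prime g).
Hypotheses (g_homog : g \is d.-homog) (t_homog : t \is d.+1.-homog).
Hypothesis g_ndvd_t : ~ mpoly_divides g t.
Implicit Types (c s u v w : {mpoly L[n]}) (m : 'X_{1..n}).

Let f : {mpoly L[n]} := g + t.

Let g_neq0 : g != 0. Proof. by case: g_prime. Qed.

Let t_neq0 : t != 0.
Proof. by apply/eqP => t0; apply: g_ndvd_t; exists 0; rewrite t0 mul0r. Qed.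

(** Constants are homogeneous, g * x_i is homogeneous of degree d + 1, and g = - t
    modulo f allows every further factor g to be replaced by one of degree d + 1. *)
Lemma homogenize c : exists k c' s,
  g ^+ k * c = c' + s * f /\ c' \is (d.+1 * k).-homog.
Proof.
have gX l : exists z, g ^+ l = (- t) ^+ l + z * f.
  exists (\sum_(i < l) g ^+ (l.-1 - i) * (- t) ^+ i).
  by rewrite mulrC /f -{2}[t]opprK -subrXX addrC subrK.
have tX l : (- t) ^+ l \is (d.+1 * l).-homog by rewrite dhomogMn // dhomogN.
elim/mpoly_generated: c => [c|i|u v|u v].
- exists 0%N, c%:MP, 0; rewrite mul1r mul0r addr0 muln0; split=> //.
  by rewrite -alg_mpolyC dhomogZ // dhomog1.
- exists 1%N, (g * 'X_i), 0; rewrite expr1 mul0r addr0 muln1; split=> //.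
  by rewrite -addn1 dhomogM // dhomogX; apply/eqP; exact: mdeg1.
- move=> [k [u' [s [eu hu]]]] [l [v' [z [ev hv]]]].
  have [x ex] := gX l; have [y ey] := gX k.
  exists (k + l)%N, ((- t) ^+ l * u' + (- t) ^+ k * v'),
    (x * u' + y * v' + g ^+ l * s + g ^+ k * z); split.
    transitivity (g ^+ l * (g ^+ k * u) + g ^+ k * (g ^+ l * v)).
      by rewrite exprD; ring.
    rewrite eu ev.
    transitivity (g ^+ l * u' + g ^+ k * v' + (g ^+ l * s + g ^+ k * z) * f); first by ring.
    by rewrite {1}ex {1}ey; ring.
  rewrite mulnDr dhomogD //; last by rewrite dhomogM.
  by rewrite addnC dhomogM.
move=> [k [u' [s [eu hu]]]] [l [v' [z [ev hv]]]].
exists (k + l)%N, (u' * v'), (u' * z + s * v' + s * z * f); split.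
  transitivity ((g ^+ k * u) * (g ^+ l * v)); first by rewrite exprD; ring.
  by rewrite eu ev; ring.
by rewrite mulnDr dhomogM.
Qed.

Lemma msupp_deformation m : (m \in msupp f) = (m \in msupp g) || (m \in msupp t).
Proof.
rewrite !mcoeff_msupp mcoeffD.
have [md|md] := eqVneq (mdeg m) d.
  by rewrite (homog_mcoeff0 t_homog) ?addr0 ?eqxx ?orbF // md neq_ltn leqnn.
by rewrite (homog_mcoeff0 g_homog) ?add0r ?eqxx.
Qed.

(** The lowest form of w * f is the product of the lowest form of w with g, and the
    highest form of w * f is the product of the highest form of w with t.  Their
    degrees differ by at least 1. *)
Lemma deformation_ndvd_homog D v : v \is D.-homog -> mpoly_divides f v -> v = 0.
Proof.
move=> hv [w ev]; apply/eqP; apply: contrapT => /negP v0.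
have w0 : w != 0 by apply: contraNneq v0 => w0; rewrite ev w0 mul0r.
have fdeg m : m \in msupp f -> (d <= mdeg m <= d.+1)%N.
  rewrite msupp_deformation => /orP[] ms; last by rewrite (homog_mdeg t_homog ms) leqnn leqnSn.
  by rewrite (homog_mdeg g_homog ms) leqnn leqnSn.
have [mg mgs] := ex_msupp g_neq0; have [mt mts] := ex_msupp t_neq0.
have ws0 : msupp w != [::] by rewrite msupp_eq0.
have [lo los lomin] := seq_argmin (@mdeg n) ws0.
have [hi his himax] := seq_argmax (@mdeg n) ws0.
have degE k l m : m \in msupp w -> (k <= mdeg m)%N ->
    (forall a b a' b', a \in msupp w -> b \in msupp f ->
     mdeg a' = mdeg m -> mdeg b' = l -> (a' + b' = a + b)%MM ->
     mdeg a = mdeg m /\ mdeg b = l) ->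
    (exists2 b, b \in msupp f & mdeg b = l) -> (mdeg m + l = D)%N.
  move=> mw _ U [b0 b0f b0l].
  have [|||a [b [_ _ /eqP ea /eqP eb]]] := @msuppM_part n L
    (fun a => mdeg a == mdeg m) (fun b => mdeg b == l) w f.
  - by apply: (part_neq0 mw).
  - by apply: (part_neq0 b0f); rewrite b0l.
  - move=> a b a' b' aw bf _ _ /eqP ea /eqP eb e.
    by have [-> ->] := U a b a' b' aw bf ea eb e; rewrite !eqxx.
  by rewrite -ev => /(homog_mdeg hv); rewrite mdegD ea eb.
have hiD : (mdeg hi + d.+1 = D)%N.
  apply: (degE 0%N) => //; last first.
    by exists mt; rewrite ?msupp_deformation ?mts ?orbT ?(homog_mdeg t_homog mts).
  move=> a b a' b' aw bf ea eb /(congr1 (@mdeg n)); rewrite !mdegD ea eb.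
  move=> /addn_extremal; apply; have /andP[_ ->] := fdeg b bf.
  by rewrite himax.
have loD : (mdeg lo + d = D)%N.
  apply: (degE 0%N) => //; last first.
    by exists mg; rewrite ?msupp_deformation ?mgs ?(homog_mdeg g_homog mgs).
  move=> a b a' b' aw bf ea eb /(congr1 (@mdeg n)); rewrite !mdegD ea eb.
  move=> /addn_extremal; apply; have /andP[-> _] := fdeg b bf.
  by rewrite lomin ?orbT.
have := lomin hi his; rewrite -(leq_add2r d) loD -hiD addnS.
by rewrite ltnn.
Qed.

(** If g c = w f = w g + w t, then g divides w t, hence w. *)
Lemma deformation_cancel k c : mpoly_divides f (g ^+ k * c) -> mpoly_divides f c.
Proof.
elim: k => [|k IH]; first by rewrite mul1r.
rewrite exprS -mulrA => -[w ew]; apply: IH.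
have [_ _ gP] := g_prime.
have [|[w' ew']|//] := gP w t.
  by exists (g ^+ k * c - w); rewrite mulrBl [X in X - _]mulrC ew /f; ring.
by exists w'; apply: (mulfI g_neq0); rewrite ew ew'; ring.
Qed.

(** By homogenize, both factors of a multiple of f may be assumed to be homogeneous;
    then their product is zero by deformation_ndvd_homog. *)
Lemma deformation_prime : mpoly_prime f.
Proof.
have [mt mts] := ex_msupp t_neq0.
have mtf : mt \in msupp f by rewrite msupp_deformation mts orbT.
split=> [||u v fuv].
- by apply: contraTneq mtf => ->; rewrite msupp0.
- apply/negP => fu; have := homog_mdeg t_homog mts.
  suff -> : mt = 0%MM by rewrite mdeg0.
  by apply/mnmP => i; rewrite mnm0E; apply: degi0P (degi_unit i fu) mtf.
have [k [u' [s [eu hu]]]] := homogenize u.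
have [l [v' [z [ev hv]]]] := homogenize v.
have : u' * v' = 0.
  apply: (deformation_ndvd_homog (dhomogM hu hv)).
  have -> : u' = g ^+ k * u - s * f by rewrite eu; ring.
  have -> : v' = g ^+ l * v - z * f by rewrite ev; ring.
  have [x ex] := fuv.
  exists (g ^+ k * g ^+ l * x - s * (g ^+ l * v) - z * (g ^+ k * u) + s * z * f).
  by transitivity (g ^+ k * g ^+ l * (u * v) - (s * (g ^+ l * v) + z * (g ^+ k * u) - s * z * f) * f);
    [ring|rewrite ex; ring].
move/eqP; rewrite mulf_eq0 => /orP[] /eqP e0.
  by left; apply: (@deformation_cancel k); exists s; rewrite eu e0 add0r.
by right; apply: (@deformation_cancel l); exists z; rewrite ev e0 add0r.
Qed.

Variables (p : nat) (pL : p \in [pchar L]).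

(** The forms T l = c g^(q-1-l) t^l have degrees D + d (q - 1) + l, all different.
    Among them T (q1 - 1), where q = q0 q1, has a monomial b with exponents below q:
    t g^(q0-1) has one below q0, and c has one below q1.  Cancellation is excluded by
    the degree, and so are the monomials q m + b, the degree of which is too large. *)
Lemma deformation_monomial D c N : c != 0 -> c \is D.-homog -> exists e (b : 'X_{1..n}),
  [/\ (N <= e)%N, forall i, (b i < p ^ e)%N, (c * f ^+ (p ^ e).-1)@_b != 0 &
      forall m, m != 0%MM -> (c * f ^+ (p ^ e).-1)@_(m *+ p ^ e + b) = 0].
Proof.
move=> c0 hc.
have [e0 _] := sqfree_prime_low pL setT g_sqfree g_prime 0%N g_ndvd_t.
set q0 := (p ^ e0)%N => lo0; have [e1 Ne1 lo1] := low_ex pL N c0.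
set q1 := (p ^ e1)%N in lo1; pose J := q1.-1.
have q0_gt0 : (0 < q0)%N := q_gt0 pL e0.
have q1_gt0 : (0 < q1)%N := q_gt0 pL e1.
have qE : (p ^ (e0 + e1) = q0 * q1)%N by rewrite expnD.
pose q := (q0 * q1)%N.
have Jq : (J < q)%N by rewrite /J prednK // leq_pmull.
pose T l := c * (g ^+ (q.-1 - l) * t ^+ l).
have hT l : (l < q)%N -> T l \is (D + d * q.-1 + l).-homog.
  move=> lq; have lq' : (l <= q.-1)%N by rewrite -ltnS prednK // muln_gt0 q0_gt0.
  have -> : (D + d * q.-1 + l = D + (d * (q.-1 - l) + d.+1 * l))%N.
    by rewrite -addnA; congr (_ + _)%N; rewrite mulSn addnCA -mulnDr subnK // [(l + _)%N]addnC.
  by rewrite !dhomogM // dhomogMn.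
have [b bT blo] : low setT q (T J).
  have := low_mul_frobenius pL lo0 lo1; rewrite -/q1 -/q.
  rewrite exprMn -exprM -{1}(prednK q1_gt0) exprS -mulrA [c * (t * _)]mulrCA => /low_mull.
  have -> : (q0.-1 * q1 = q.-1 - J)%N.
    by rewrite /J /q -predn_sub -subnS prednK // -subn1 mulnBl mul1n.
  by rewrite /T [g ^+ _ * _]mulrC.
have uE : c * f ^+ q.-1 = \sum_(l < q) (-1) ^+ l *: T l.
  rewrite /f /q -qE (addX_pred (pchar_mpoly n pL)); last first.
    by have [] := deformation_prime.
  rewrite mulr_sumr; apply: eq_bigr => l _; rewrite /T /q -qE [(- t) ^+ _]exprNn.
  by rewrite -mul_mpolyC rmorphXn rmorphN rmorph1; ring.
have bdeg : mdeg b = (D + d * q.-1 + J)%N by rewrite (homog_mdeg (hT _ Jq) bT).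
exists (e0 + e1)%N, b; rewrite qE -/q; split.
- by rewrite (leq_trans Ne1) // leq_addl.
- by move=> i; apply: blo; rewrite inE.
- rewrite uE raddf_sum /= (bigD1 (Ordinal Jq)) //= big1 ?addr0.
    by rewrite mcoeffZ mulf_neq0 ?signr_eq0 // -mcoeff_msupp.
  move=> l lJ; rewrite mcoeffZ (homog_mcoeff0 (hT l (ltn_ord l))) ?mulr0 //.
  by rewrite bdeg eqn_add2l eq_sym; apply: contra lJ => /eqP e; apply/eqP/val_inj.
move=> m m0; rewrite uE raddf_sum big1 //= => l _.
rewrite mcoeffZ (homog_mcoeff0 (hT l (ltn_ord l))) ?mulr0 // mdegD mdegMn bdeg.
rewrite neq_ltn; apply/orP; right; rewrite addnCA ltn_add2l.
apply: leq_trans (ltn_ord l) _; rewrite -[q in (q <= _)%N]mul1n.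
by apply: leq_trans (leq_addr _ _); rewrite leq_mul2r lt0n mdeg_eq0 m0 orbT.
Qed.

End Deformation.

(** * Fedder's criterion *)
Section IdealSpan.
Variable R : comNzRingType.
Implicit Types (I A : R -> Prop).

Lemma ideal0 I : is_ideal I -> I 0. Proof. by case. Qed.

Lemma idealD I u v : is_ideal I -> I u -> I v -> I (u + v).
Proof. by case=> _ H Iu Iv; have := H 1 u v Iu Iv; rewrite mul1r. Qed.

Lemma idealMl I a u : is_ideal I -> I u -> I (a * u).
Proof. by move=> iI Iu; case: (iI) => I0 H; have := H a u 0 Iu I0; rewrite addr0. Qed.

Lemma idealB I u v : is_ideal I -> I u -> I v -> I (u - v).
Proof. by move=> iI Iu Iv; apply: idealD => //; rewrite -mulN1r; apply: idealMl. Qed.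

Lemma ideal_span_ideal A : is_ideal (ideal_span A).
Proof.
split=> [I [] //|a u v Au Av I iI AI].
by apply: idealD => //; [apply: idealMl => //; apply: Au|apply: Av].
Qed.

Lemma ideal_of_seq_ideal (r : seq R) : is_ideal (ideal_of_seq r).
Proof. exact: ideal_span_ideal. Qed.

Lemma frobenius_power_ideal I q : is_ideal (frobenius_power I q).
Proof. exact: ideal_span_ideal. Qed.

Lemma ideal_span_gen A a : A a -> ideal_span A a.
Proof. by move=> Aa I _; apply. Qed.

End IdealSpan.

(** L[x] is free over L[x^q] with the monomials of exponents below q as a basis; this is
    the coordinate at x^b, with x^q renamed x.  Roots are taken of the variables but
    not of the coefficients, and so L need not be perfect. *)
Definition cartier (n : nat) (L : fieldType) (q : nat) (b : 'X_{1..n}) :=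
  @monomial_ext n L (fun m => if [forall i, m i %% q == b i]%N
                              then 'X_[[multinom m i %/ q | i < n]] else 0).

HB.instance Definition _ n L q b :=
  GRing.Linear.copy (@cartier n L q b) (@monomial_ext n L _).

Lemma cartierX n (L : fieldType) q (b m : 'X_{1..n}) : cartier q b 'X_[L, m] =
  if [forall i, m i %% q == b i]%N then 'X_[[multinom m i %/ q | i < n]] else 0.
Proof. exact: monomial_extX. Qed.

Section Fedder.
Variables (p n : nat) (L : fieldType) (pL : p \in [pchar L]) (e : nat).
Variables (I : {mpoly L[n]} -> Prop) (iI : is_ideal I).
Implicit Types (a u v w : {mpoly L[n]}) (m b : 'X_{1..n}).

Let q := (p ^ e)%N.
Let q_pos : (0 < q)%N := q_gt0 pL e.

Lemma mcoeff_cartier b v m : (forall i, (b i < q)%N) ->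
  (cartier q b v)@_m = v@_(m *+ q + b).
Proof.
move=> bq; rewrite /cartier /monomial_ext raddf_sum /=.
rewrite [in RHS](mpolyE v) raddf_sum /=; apply: eq_bigr => k _; rewrite !mcoeffZ mcoeffX.
congr (_ * _); case: ifP => [/forallP kb|/negP kb].
  rewrite mcoeffX; congr (nat_of_bool _)%:R; apply/eqP/eqP => /mnmP E; apply/mnmP => i.
    by rewrite mnmDE mulmnE -E mnmE -(eqP (kb i)) -divn_eq.
  by rewrite mnmE E mnmDE mulmnE divnMDl // divn_small ?addn0.
rewrite mcoeff0; case: eqP => // E; case: kb; apply/forallP => i.
by rewrite E mnmDE mulmnE modnMDl modn_small.
Qed.

Lemma cartierMX b m v : (forall i, (b i < q)%N) ->
  cartier q b ('X_[m *+ q] * v) = 'X_[m] * cartier q b v.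
Proof.
move=> bq; rewrite (mpolyE v) mulr_sumr !raddf_sum mulr_sumr /=; apply: eq_bigr => k _.
rewrite -scalerAr -mpolyXD !linearZ /= -scalerAr !cartierX; congr (_ *: _).
have -> : [forall i, (m *+ q + k)%MM i %% q == b i]%N = [forall i, k i %% q == b i]%N.
  by apply: eq_forallb => i; rewrite mnmDE mulmnE modnMDl.
case: ifP => _; rewrite ?mulr0 // -mpolyXD; congr 'X_[_]; apply/mnmP => i.
by rewrite mnmDE !mnmE mulmnE divnMDl.
Qed.

Variable (F : {rmorphism L -> L}) (FE : forall x, F x = x ^+ q).

Lemma cartierM b w v : (forall i, (b i < q)%N) ->
  cartier q b (w ^+ q * v) = map_mpoly F w * cartier q b v.
Proof.
move=> bq; rewrite (frobeniusE pL) [in RHS](mpolyE w) rmorph_sum !mulr_suml raddf_sum /=.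
apply: eq_bigr => m _; rewrite -!scalerAl linearZ /= cartierMX //.
by rewrite map_mpolyZ map_mpolyX FE scalerAl.
Qed.

(** The ideal generated by the image of I under the map that raises the coefficients to
    the q-th power.  Finite sums with scalar coefficients suffice, since I is an
    ideal and every monomial is the image of a monomial. *)
Definition twisted_span u := exists2 s : seq (L * {mpoly L[n]}),
  forall x, x \in s -> I x.2 & u = \sum_(x <- s) x.1 *: map_mpoly F x.2.

Lemma twisted_spanD u v : twisted_span u -> twisted_span v -> twisted_span (u + v).
Proof.
move=> [s sI ->] [s' s'I ->]; exists (s ++ s'); last by rewrite big_cat.
by move=> x; rewrite mem_cat => /orP[/sI|/s'I].
Qed.

Lemma twisted_spanM a u : twisted_span u -> twisted_span (a * u).
Proof.
elim/mpoly_generated: a u => [c|i|a a' IH IH'|a a' IH IH'] u.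
- move=> [s sI ->]; exists [seq (c * x.1, x.2) | x <- s]; first by move=> _ /mapP[x /sI ? ->].
  rewrite big_map mulr_sumr; apply: eq_bigr => x _.
  by rewrite mul_mpolyC scalerA.
- move=> [s sI ->]; exists [seq (x.1, 'X_i * x.2) | x <- s].
    by move=> _ /mapP[x /sI ? ->]; apply: idealMl.
  rewrite big_map mulr_sumr; apply: eq_bigr => x _.
  by rewrite rmorphM /= map_mpolyX scalerAr.
- by move=> Zu; rewrite mulrDl; apply: twisted_spanD; [apply: IH|apply: IH'].
by move=> Zu; rewrite -mulrA; apply: IH; apply: IH'.
Qed.

(** Linear equations with coefficients in a subfield that are solvable in the field are
    solvable in the subfield; here the subfield is the image of F.  As in Artin's
    lemma, one term l *: w is eliminated at a time, by subtracting from r and from the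
    other w' the multiple of w that cancels their coefficient at a monomial m of w. *)
Lemma twisted_span_descent r : twisted_span (map_mpoly F r) -> I r.
Proof.
move=> [s]; have [N] := ubnP (size s); elim: N s r => // N IH [|[l w] s] r sN sI.
  rewrite big_nil -(rmorph0 (map_mpoly F)) => /(@map_mpoly_inj _ _ _ F) ->.
  exact: ideal0.
have Iw : I w by apply: (sI (l, w)); rewrite mem_head.
have sI' x : x \in s -> I x.2 by move=> xs; apply: sI; rewrite inE xs orbT.
rewrite big_cons /=; have [w0|w0] := eqVneq w 0.
  by rewrite w0 rmorph0 scaler0 add0r; apply: IH.
have [m mw] := ex_msupp w0; have k0 : w@_m != 0 by rewrite -mcoeff_msupp.
move=> E; pose red v := v - (v@_m / w@_m) *: w.
have redI v : I (red v) -> I v.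
  move=> Iv; rewrite -[v](subrK ((v@_m / w@_m) *: w)) -/(red v).
  by apply: idealD => //; rewrite -mul_mpolyC; apply: idealMl.
apply: redI; apply: (IH [seq (x.1, red x.2) | x <- s]).
- by rewrite size_map.
- move=> _ /mapP[x /sI' Ix ->]; apply: idealB => //.
  by rewrite -mul_mpolyC; apply: idealMl.
rewrite big_map /= /red rmorphB /= map_mpolyZ fmorph_div.
under eq_bigr => x _ do rewrite rmorphB /= map_mpolyZ fmorph_div scalerBr scalerA mulrA.
rewrite sumrB -scaler_suml -mulr_suml.
have E1 : F r@_m = l * F w@_m + \sum_(x <- s) x.1 * F x.2@_m.
  rewrite -mcoeff_map_mpoly E mcoeffD mcoeffZ mcoeff_map_mpoly raddf_sum /=; congr (_ + _).
  by apply: eq_bigr => x _; rewrite mcoeffZ mcoeff_map_mpoly.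
rewrite E E1 mulrDl mulfK ?fmorph_eq0 // scalerDl opprD addrACA subrr add0r.
by [].
Qed.

(** Applying the coordinate at x^b to u r^q in I^[q] yields u@_b times the image of r
    under F, because that coordinate of u is the constant u@_b. *)
Lemma cartier_descent b u r : (forall i, (b i < q)%N) -> u@_b != 0 ->
  (forall m, m != 0%MM -> u@_(m *+ q + b) = 0) ->
  frobenius_power I q (u * r ^+ q) -> I r.
Proof.
move=> bq ub u0 H; apply: twisted_span_descent.
have cu : cartier q b u = (u@_b)%:MP.
  apply/mpolyP => m; rewrite mcoeff_cartier // mcoeffC.
  have [->|m0] := eqVneq m 0%MM; last by rewrite mulr0 u0.
  by rewrite mulr1; congr (_@__); apply/mnmP => i; rewrite mnmDE mulmnE mnm0E.
have : forall a, twisted_span (cartier q b (a * (u * r ^+ q))).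
  apply: (H (fun v => forall a, twisted_span (cartier q b (a * v)))).
    split=> [a|a v w Hv Hw a'].
      by rewrite mulr0 raddf0; exists [::]; rewrite ?big_nil.
    by rewrite mulrDr raddfD; apply: twisted_spanD; rewrite ?mulrA; [apply: Hv|apply: Hw].
  move=> _ [w Iw ->] a; rewrite mulrC cartierM // mulrC; apply: twisted_spanM.
  by exists [:: (1, w)] => [x|]; rewrite ?big_seq1 ?scale1r // inE => /eqP ->.
move/(_ 1); rewrite mul1r [u * _]mulrC cartierM // cu mulrC mul_mpolyC.
move/(twisted_spanM (u@_b)^-1%:MP); rewrite mul_mpolyC scalerA mulVf // scale1r.
by [].
Qed.

End Fedder.

(** * Hilbert's basis theorem *)
Section Noetherian.
Variables (n : nat) (L : fieldType).
Implicit Types (u v w : {mpoly L[n]}) (m : 'X_{1..n}).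

(** Induction on the number k of variables in which the monomials are compared.  Let s0
    work for the first k variables and let N be the largest exponent of the next
    variable in s0.  Then s0 takes care of the monomials in which this exponent is at
    least N; the others belong to finitely many slices, where it is constant. *)
Lemma dickson (A : 'X_{1..n} -> Prop) : exists s : seq 'X_{1..n},
  (forall m, m \in s -> A m) /\ forall m, A m -> exists2 m', m' \in s & (m' <= m)%MM.
Proof.
have H k : forall A : 'X_{1..n} -> Prop, exists s : seq 'X_{1..n},
    (forall m, m \in s -> A m) /\
    forall m, A m -> exists2 m', m' \in s & forall i : 'I_n, (i < k)%N -> (m' i <= m i)%N.
  elim: k => [|k IH] {}A.
    have [[m Am]|nA] := EM (exists m, A m); last by exists [::]; split=> // m Am; case: nA; exists m.
    by exists [:: m]; split=> [m'|m' _]; [rewrite inE => /eqP ->|exists m; rewrite ?mem_head].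
  have [s0 [s0A s0P]] := IH A.
  have [nk|kn] := leqP n k.
    exists s0; split=> // m /s0P[m' m's lem]; exists m' => // i _.
    exact/lem/(leq_trans (ltn_ord i)).
  pose j := Ordinal kn; pose N := \max_(m <- s0) m j.
  have /choice[t tP] c := IH (fun m => A m /\ m j = c).
  exists (s0 ++ flatten [seq t c | c <- iota 0 N]); split=> [m|m Am].
    rewrite mem_cat => /orP[/s0A //|/flattenP[_ /mapP[c _ ->] mt]].
    by have [/(_ m mt)[]] := tP c.
  have [Nm|mN] := leqP N (m j).
    have [m' m's lem] := s0P m Am; exists m' => [|i]; first by rewrite mem_cat m's.
    rewrite ltnS leq_eqVlt => /orP[/eqP ik|/lem //].
    have -> : i = j by apply/val_inj.
    by apply: leq_trans Nm; exact: (leq_bigmax_seq _ m's).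
  have [tA /(_ m (conj Am erefl))[m' m't lem]] := tP (m j).
  exists m' => [|i].
    rewrite mem_cat; apply/orP; right; apply/flattenP; exists (t (m j)) => //.
    by apply/mapP; exists (m j) => //; rewrite mem_iota.
  rewrite ltnS leq_eqVlt => /orP[/eqP ik|/lem //].
  have -> : i = j by apply/val_inj.
  by have [_ ->] := tA _ m't.
have [s [sA sP]] := H n A; exists s; split=> // m /sP[m' m's lem]; exists m' => //.
by apply/mnm_lepP => i; apply: lem.
Qed.

(** An ideal is generated by elements whose leading monomials generate, in the sense of
    dickson, all leading monomials of the ideal: any other element can be reduced by
    them. *)
Lemma mpoly_noetherian : noetherian {mpoly L[n]}.
Proof.
move=> I iI.
have [s [sA sP]] := dickson (fun m => exists v, [/\ I v, v != 0 & mlead v = m]).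
have /choice[G GP] m : exists v, m \in s -> [/\ I v, v != 0 & mlead v = m].
  have [ms|ms] := boolP (m \in s); last by exists 0.
  by have [v vP] := sA m ms; exists v.
exists [seq G m | m <- s] => u; split; last first.
  by move=> H; apply: (H I iI) => _ /mapP[m /GP[? _ _] ->].
elim/mleadrect: u => u IH Iu.
have [->|u0] := eqVneq u 0; first exact: (ideal0 (ideal_of_seq_ideal _)).
have [m' m's lem] : exists2 m', m' \in s & (m' <= mlead u)%MM by apply: sP; exists u.
have [Ig g0 gm] := GP m' m's; set g := G m' in Ig g0 gm.
pose c := mleadc u / mleadc g; pose h := c *: ('X_[mlead u - m'] * g).
have ug : mleadc u != 0 by rewrite mleadc_eq0.
have gg : mleadc g != 0 by rewrite mleadc_eq0.
have hgen : ideal_of_seq [seq G m | m <- s] h.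
  rewrite /h -mul_mpolyC mulrA; apply: (idealMl _ (ideal_of_seq_ideal _)).
  by apply: ideal_span_gen; apply: map_f.
have Ih : I h by rewrite /h -mul_mpolyC mulrA; apply: idealMl.
have hlead : mlead h = mlead u.
  rewrite /h mleadZ; last by rewrite mulf_neq0 ?invr_eq0.
  rewrite mleadM ?mleadXm ?gm ?submK //.
  by apply/eqP => X0; have := msuppX L (mlead u - m'); rewrite X0 msupp0.
have hc : h@_(mlead u) = mleadc u.
  have : (g * 'X_[mlead u - m'])@_(mlead u - m' + m') = g@_m' by rewrite mcoeffMX.
  by rewrite submK // => E; rewrite /h mcoeffZ [_ * g]mulrC E -gm divfK.
rewrite -[u](subrK h); apply: (idealD (ideal_of_seq_ideal _)) => //.
have [->|uh0] := eqVneq (u - h) 0; first exact: (ideal0 (ideal_of_seq_ideal _)).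
apply: IH; last exact: idealB.
rewrite lt_neqAle; apply/andP; split; last first.
  by apply: le_trans (mleadB_le _ _) _; rewrite hlead joinxx.
apply: contraNneq uh0 => e; rewrite -mleadc_eq0 e mcoeffB hc subrr.
by [].
Qed.

Lemma quotient_noetherian (J : idealr {mpoly L[n]}) : noetherian {ideal_quot J}.
Proof.
move=> I iI; pose pJ : {rmorphism {mpoly L[n]} -> {ideal_quot J}} := \pi_{ideal_quot J}%qT.
have [|r rP] := @mpoly_noetherian (fun u => I (pJ u)).
  split=> [|a u v Iu Iv]; rewrite ?rmorph0 ?rmorphD ?rmorphM; first exact: ideal0.
  by apply: idealD => //; apply: idealMl.
exists [seq pJ u | u <- r]; elim/quotW => u; split=> [Iu|H].
  have /rP H : I (pJ u) by [].
  apply: (H (fun v => ideal_of_seq [seq pJ u | u <- r] (pJ v))) => [|a ar].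
    split=> [|a v w Hv Hw]; first by rewrite rmorph0; exact: (ideal0 (ideal_of_seq_ideal _)).
    rewrite rmorphD rmorphM; apply: (idealD (ideal_of_seq_ideal _)) => //.
    exact: (idealMl _ (ideal_of_seq_ideal _)).
  by apply: ideal_span_gen; apply: map_f.
apply: H => // _ /mapP[v vr ->]; apply/rP.
exact: ideal_span_gen.
Qed.

End Noetherian.

(** * The quotient by a prime polynomial *)
Section PrincipalQuotient.
Variables (n : nat) (L : fieldType) (f : {mpoly L[n]}) (f_prime : mpoly_prime f).

Lemma principal_ideal_exists :
  exists J : idealr {mpoly L[n]}, forall u, u \in J <-> mpoly_divides f u.
Proof.
pose S : pred {mpoly L[n]} := fun u => `[< mpoly_divides f u >].
have S_closed : idealr_closed S.
  split=> [||a u v].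
  - by apply/asboolP; exists 0; rewrite mul0r.
  - apply/negP => /asboolP[u e]; have [_ /negP fu _] := f_prime; apply: fu.
    by apply/unitrP; exists u; rewrite [f * u]mulrC -e.
  move=> /asboolP[x ->] /asboolP[y ->]; apply/asboolP.
  by exists (a * x + y); ring.
pose JI := isIdealr.Build _ S S_closed.
pose J : idealr {mpoly L[n]} := HB.pack S JI.
by exists J => u; split=> [/asboolP|H]; [|apply/asboolP].
Qed.

Variables (J : idealr {mpoly L[n]}) (JE : forall u, u \in J <-> mpoly_divides f u).

Let pJ : {rmorphism {mpoly L[n]} -> {ideal_quot J}} := \pi_{ideal_quot J}%qT.

Lemma quot_eqP u v : pJ u = pJ v <-> exists s, u = v + s * f.
Proof.
have -> : (pJ u = pJ v) <-> (u - v \in J).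
  by rewrite Quotient.idealrBE; split=> [/eqP|/eqP].
split=> [/JE[s e]|[s ->]]; first by exists s; rewrite -e addrC subrK.
by apply/JE; exists s; ring.
Qed.

Lemma quot_eq0 u : pJ u = 0 <-> mpoly_divides f u.
Proof.
rewrite -(rmorph0 pJ); split=> [/quot_eqP[s ->]|[s ->]]; first by exists s; rewrite add0r.
by apply/quot_eqP; exists s; rewrite add0r.
Qed.

(** This ideal is contained in all others, so that it is the only minimal prime and the
    multipliers in the definition of tight closure are the non-zero elements. *)
Lemma quot_zero_prime : exists P : prime_idealr {ideal_quot J}, forall x, x \in P <-> x = 0.
Proof.
pose S : pred {ideal_quot J} := fun x => x == 0.
have S_closed : idealr_closed S.
  split=> [||a u v]; rewrite !unfold_in ?eqxx ?oner_neq0 // => /eqP -> /eqP ->.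
  by rewrite mulr0 addr0.
have S_prime : prime_idealr_closed S.
  elim/quotW=> u; elim/quotW=> v; rewrite !unfold_in => /eqP uv0.
  have [_ _ fP] := f_prime.
  have /quot_eq0 : pJ (u * v) = 0 by rewrite rmorphM.
  by case/fP => /quot_eq0 e; apply/orP; [left|right]; apply/eqP.
pose SI := isIdealr.Build _ S S_closed.
pose SP := isPrimeIdealrClosed.Build _ S S_prime.
pose P : prime_idealr {ideal_quot J} := HB.pack S SI SP.
by exists P => x; split=> [/eqP|->]; [|apply/eqP].
Qed.

(** A representative is determined up to multiples s * f, and after multiplication by
    f^(q-1) these lie in the q-th Frobenius power of any ideal that contains f. *)
Lemma frobenius_power_lift (I : {ideal_quot J} -> Prop) q x u : (0 < q)%N -> is_ideal I ->
  frobenius_power I q x -> pJ u = x ->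
  frobenius_power (fun v => I (pJ v)) q (f ^+ q.-1 * u).
Proof.
move=> q0 iI Ix; set I' := fun v => _.
have idp : is_ideal (frobenius_power I' q) := frobenius_power_ideal _ _.
have fq s : frobenius_power I' q (f ^+ q.-1 * (s * f)).
  have -> : f ^+ q.-1 * (s * f) = s * f ^+ q by rewrite -{2}(prednK q0) exprS; ring.
  apply: (idealMl _ idp); apply: ideal_span_gen; exists f => //.
  by rewrite /I' (quot_eq0 f).2; [exact: ideal0|exists 1; rewrite mul1r].
move: u; apply: (Ix (fun x => forall u, pJ u = x -> frobenius_power I' q (f ^+ q.-1 * u))).
  split=> [u|].
    by move/quot_eq0 => [s ->]; apply: fq.
  elim/quotW=> a; elim/quotW=> y; elim/quotW=> z Hy Hz u.
  move=> e; have /quot_eqP[s ->] : pJ u = pJ (a * y + z) by rewrite rmorphD rmorphM.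
  rewrite !mulrDr mulrCA; apply: (idealD idp) => //; apply: (idealD idp).
    by apply: (idealMl _ idp); apply: Hy.
  exact: Hz.
move=> x0 [w Iw ->] u; elim/quotW: w Iw => w Iw e.
have /quot_eqP[s ->] : pJ u = pJ (w ^+ q) by rewrite rmorphXn.
rewrite mulrDr; apply: (idealD idp) => //; apply: (idealMl _ idp).
by apply: ideal_span_gen; exists w.
Qed.

End PrincipalQuotient.

(** * Tight closure modulo g + t *)
Section DeformationQuotient.
Variables (p n d : nat) (L : fieldType) (pL : p \in [pchar L]).
Variables (g t : {mpoly L[n]}).
Hypotheses (g_sqfree : square_free_supported g) (g_prime : mpoly_prime g).
Hypotheses (g_homog : g \is d.-homog) (t_homog : t \is d.+1.-homog).
Hypothesis g_ndvd_t : ~ mpoly_divides g t.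
Variables (J : idealr {mpoly L[n]}) (JE : forall u, u \in J <-> mpoly_divides (g + t) u).

(** The multiplier c may be replaced by a power of g times c, that is, by a homogeneous
    polynomial c', which is non-zero as f is prime and does not divide c. *)
Lemma deformation_tightly_closed (I : {ideal_quot J} -> Prop) :
  is_ideal I -> tightly_closed p I.
Proof.
move=> iI x; have f_prime := deformation_prime g_prime g_homog t_homog g_ndvd_t.
pose pJ : {rmorphism {mpoly L[n]} -> {ideal_quot J}} := \pi_{ideal_quot J}%qT.
split=> [[c cP [e0 cx]]|Ix]; last first.
  exists 1 => [P _|]; first by rewrite idealr1.
  by exists 0%N => e _; rewrite mul1r; apply: ideal_span_gen; exists x.
have [P PE] := quot_zero_prime f_prime JE.
have c0 : c <> 0.
  move=> c0; have : c \notin P.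
    by apply: cP => Q _ y /PE ->; rewrite rpred0.
  by rewrite (PE c).2.
elim/quotW: c c0 {cP} cx => c c0; elim/quotW: x => x cx.
have [k [c' [s [ec hc']]]] := homogenize g_homog t_homog c.
have c'0 : c' != 0.
  apply/eqP => c'0; apply: c0; apply/(quot_eq0 JE).
  apply: (deformation_cancel g_prime g_ndvd_t (k := k)).
  by exists s; rewrite ec c'0 add0r.
have [e [b [ele bq ub u0]]] :=
  deformation_monomial g_sqfree g_prime g_homog t_homog g_ndvd_t pL e0 c'0 hc'.
have [F FE] := frobenius_iter pL e.
have iI' : is_ideal (fun v => I (pJ v)).
  split=> [|a u v Iu Iv]; first by rewrite rmorph0; exact: ideal0.
  by rewrite rmorphD rmorphM; apply: idealD => //; apply: idealMl.
apply: (cartier_descent pL iI' FE bq ub u0).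
rewrite [c' * _]mulrC -mulrA.
apply: (frobenius_power_lift JE (q_gt0 pL e) iI (x := pJ (g ^+ k) * (pJ c * pJ x ^+ (p ^ e)))).
  by apply: (idealMl _ (frobenius_power_ideal _ _)); apply: cx.
rewrite -rmorphXn -!rmorphM; apply/(quot_eqP JE).
by exists (- (s * x ^+ (p ^ e))); rewrite mulrA ec; ring.
Qed.

Lemma deformation_F_rational : F_rational p {ideal_quot J}.
Proof.
split.
- exact: quotient_noetherian.
- exact: (rmorph_pchar (\pi_{ideal_quot J}%qT \o @mpolyC n L)).
move=> I [r [rI _]]; apply: deformation_tightly_closed.
have [i0 iD] := ideal_of_seq_ideal r.
by split=> [|a u v /rI Iu /rI Iv]; apply/rI => //; apply: iD.
Qed.

End DeformationQuotient.

Theorem corollary2p17 (p : nat) (K : fieldType) (charK : p \in [pchar K])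
    (n d : nat) (g h : {mpoly K[n]}) (a : 'I_n -> K)
    (g_sqfree : square_free_supported g) (h_sqfree : square_free_supported h)
    (g_homog : g \is d.-homog) (h_homog : h \is d.+1.-homog)
    (g_irr : mpoly_irreducible g) (g_ndvd_h : ~ mpoly_divides g h) :
  let l : {mpoly K[n]} := \sum_(i < n) a i *: 'X_i + 1 in
  let f : {mpoly K[n]} := g * l + h in
  geometrically_irreducible f /\
  geometrically_F_rational p (ideal_of_seq [:: f]).
Proof.
move=> l f.
have [g0 _ _] := g_irr.
have H (L : fieldType) (iota : {rmorphism K -> L}) : exists g' t : {mpoly L[n]},
    [/\ map_mpoly iota f = g' + t, square_free_supported g', mpoly_prime g' &
     [/\ g' \is d.-homog, t \is d.+1.-homog & ~ mpoly_divides g' t]].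
  pose lam : {mpoly K[n]} := \sum_(i < n) a i *: 'X_i.
  exists (map_mpoly iota g), (map_mpoly iota (g * lam + h)); split.
  - by rewrite -rmorphD /f /l; congr map_mpoly; rewrite /lam; ring.
  - exact: sqfree_map.
  - by apply: sqfree_irreducible_prime; [exact: sqfree_map|exact: sqfree_irreducible_map].
  split; [exact: dhomog_map| |].
    apply: dhomog_map; rewrite rpredD // -addn1 dhomogM //.
    by apply: rpred_sum => i _; apply: rpredZ; rewrite dhomogX; apply/eqP; exact: mdeg1.
  move=> [u]; rewrite rmorphD rmorphM => e; apply: g_ndvd_h.
  apply: (sqfree_divides_map (iota := iota) g0 h_sqfree).
  exists (u - map_mpoly iota lam); rewrite mulrBl -e; ring.
split=> L iota; have [g' [t [ef sg pg [hg ht ndvd]]]] := H L iota.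
  by rewrite ef; apply: prime_irreducible; apply: deformation_prime ht ndvd.
have fP := deformation_prime pg hg ht ndvd.
have [J JE] := principal_ideal_exists fP.
exists J; split; last first.
  by apply: (deformation_F_rational _ sg pg hg ht ndvd JE); apply: (rmorph_pchar iota).
move=> u; apply: iff_trans (JE u) _; rewrite -ef; split=> [[v ->]|H'].
  apply: (idealMl _ (ideal_span_ideal _)).
  by apply: ideal_span_gen; exists f => //; apply: ideal_span_gen; rewrite inE.
apply: (H' (mpoly_divides (map_mpoly iota f))).
  split=> [|x y z [y' ->] [z' ->]]; first by exists 0; rewrite mul0r.
  by exists (x * y' + z'); ring.
move=> _ [w wf ->].
apply: (wf (fun w => mpoly_divides (map_mpoly iota f) (map_mpoly iota w))).
  split=> [|x y z [y' ey] [z' ez]]; first by exists 0; rewrite mul0r rmorph0.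
  by exists (map_mpoly iota x * y' + z'); rewrite rmorphD rmorphM /= ey ez; ring.
by move=> v; rewrite inE => /eqP ->; exists 1; rewrite mul1r.
Qed.
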